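(* Let $(M,g,\circ,e,\mathcal{E})$ be a Frobenius manifold. Suppose that there exists a $\mathbb{C}$-anti-linear involution $\kappa$ such that $(M,g,\circ,e,\mathcal{E},\kappa)$ is a CDV-structure. Let $\nabla$ be the Levi-Civita connection of $g$ and $D'$ the $(1,0)$-part of the Chern connection of $h=g(\cdot,\kappa\,\cdot)$. (1) The following properties are equivalent: (a) $\kappa$ is $\nabla$-flat; (b) $D'=\nabla$. (2) If these properties are satisfied and $(M,g,\circ,e,\mathcal{E})$ is semi-simple, then any canonical local coordinate system $(u^1,\dots,u^m)$ of $(M,g,\circ,e,\mathcal{E})$ is $\nabla$-flat and $\mathcal{Q}=0$. In particular, the semi-simple Frobenius manifold is trivial. Moreover, if $(M,g,\circ,e,\mathcal{E},\kappa)$ is a CDV$\oplus$-structure, then in any such system of coordinates, with $\eta_\alpha:=g(\partial_{u^\alpha},\partial_{u^\alpha})$, one has $\kappa\,\partial_{u^\alpha}=\frac{|\eta_\alpha|}{\eta_\alpha}\partial_{u^\alpha}$ for all $\alpha$, and the matrix of $h$ is $\mathrm{diag}(|\eta_1|,\dots,|\eta_m|)$.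
   Context: Frobenius manifold. $M$ is a complex analytic manifold of dimension $m$, $\Theta_M$ is its sheaf of holomorphic vector fields; $g$ is a holomorphic symmetric non-degenerate bilinear form on $\Theta_M$ with Levi-Civita connection $\nabla$; $\circ$ is a holomorphic commutative associative product on $\Theta_M$ with unit field $e$; $\mathcal{E}$ is a holomorphic vector field (Euler field). These satisfy: $\nabla$ is flat; $g(X\circ Y,Z)=g(X,Y\circ Z)$; $\nabla e=0$; with $c(X,Y,Z):=g(X\circ Y,Z)$ the tensor $(\nabla_Zc)(U,V,W)$ is symmetric in its four arguments; $\nabla(\nabla\mathcal{E})=0$, $\mathcal{L}_{\mathcal{E}}(\circ)=\circ$, and $\mathcal{L}_{\mathcal{E}}(g)=(2-d)g$ for some constant $d$. It is semi-simple if near every point there are holomorphic coordinates $(u^1,\dots,u^m)$, called canonical, with $\partial_{u^\alpha}\circ\partial_{u^\beta}=\delta_{\alpha\beta}\partial_{u^\alpha}$. Coordinates $(t^i)$ are $\nabla$-flat if $\nabla\partial_{t^i}=0$ for all $i$. Locally, in flat coordinates $(t^i)$, there is a potential function $F$ with $\partial^3F/\partial t^i\partial t^j\partial t^k=g(\partial_{t^i}\circ\partial_{t^j},\partial_{t^k})$. The Frobenius manifold is trivial if, locally, the potential function is a polynomial of degree three when expressed in some holomorphic $\nabla$-flat local coordinates. $\mathcal{T}_M^{(1,0)}$ is the $C^\infty$ complex vector bundle underlying the holomorphic tangent bundle, with its operator $\overline\partial$; $g$, $\circ$ are extended $C^\infty$-linearly and $\nabla$ is extended to a $(1,0)$-connection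 on $\mathcal{T}_M^{(1,0)}$. $\kappa$ is called $\nabla$-flat if $(\nabla+\overline\partial)(\kappa)=0$, i.e. $\nabla_X\kappa=\kappa\,\overline\partial_{\overline X}$ and $\overline\partial_{\overline X}\kappa=\kappa\nabla_X$ for $X$ of type $(1,0)$. The Chern connection $D_h=D'+\overline\partial$ of a Hermitian pseudo-metric $h$ is the unique connection with $(0,1)$-part $\overline\partial$ and $D_h(h)=0$. CDV-structure. Given a Frobenius manifold and a smooth fiberwise $\mathbb{C}$-anti-linear involution $\kappa$ of $\mathcal{T}_M^{(1,0)}$, put $h:=g(\cdot,\kappa\,\cdot)$, $D:=D_h$ with $(1,0)$-part $D'$ and $(0,1)$-part $D''=\overline\partial$, $C_XY:=-X\circ Y$, $\tilde C:=\kappa C\kappa$ (i.e. $\tilde C_{\overline X}=\kappa C_X\kappa$), $\mathcal{U}:=\mathcal{E}\circ$, $\mathcal{Q}:=D_{\mathcal{E}}-\mathcal{L}_{\mathcal{E}}-\frac{2-d}{2}\mathrm{Id}$. One says $(M,g,\circ,e,\mathcal{E},\kappa)$ is a CDV-structure if $d\in\mathbb{R}$, $D_ee=0$, and $(\mathcal{T}_M^{(1,0)}\to M,D,C,\tilde C,\kappa,h,\mathcal{U},\mathcal{Q})$ is a CV-structure, i.e.: (1) $(C+D'')^2=0$, $(\tilde C+D')^2=0$, $D'(C)=0$, $D''(\tilde C)=0$, $D'D''+D''D'=-(C\tilde C+\tilde CC)$; (2) $\kappa^2=\mathrm{Id}$, $D(\kappa)=0$ (i.e. $D'_X\kappa=\kappa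 D''_{\overline X}$ and $D''_{\overline X}\kappa=\kappa D'_X$), $\kappa C\kappa=\tilde C$; (3) $h$ is a Hermitian pseudo-metric (linear on the left, semi-linear on the right, non-degenerate, $h(b,a)=\overline{h(a,b)}$), real-valued on $\ker(\kappa-\mathrm{Id})$, with $h(C_Xa,b)=h(a,\tilde C_{\overline X}b)$ and $D(h)=0$; (4) $[C,\mathcal{U}]=0$, $D'(\mathcal{U})-[C,\mathcal{Q}]+C=0$, $D''(\mathcal{U})=0$, $D'(\mathcal{Q})+[C,\kappa\mathcal{U}\kappa]=0$, $\kappa\mathcal{Q}\kappa+\mathcal{Q}=0$, $h(\mathcal{U}a,b)=h(a,\kappa\mathcal{U}\kappa b)$, $h(\mathcal{Q}a,b)=h(a,\mathcal{Q}b)$. It is a CDV$\oplus$-structure if in addition $h$ is positive definite. *)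

(* Defs.v *)
From HB Require Import structures.
From mathcomp Require Import all_boot all_order all_algebra complex.
From mathcomp Require mpoly.
From mathcomp Require Import all_classical all_reals all_analysis.
Import Order.TTheory GRing.Theory Num.Theory numFieldNormedType.Exports.

Set Implicit Arguments.
Unset Strict Implicit.
Unset Printing Implicit Defensive.

Local Open Scope classical_set_scope.
Local Open Scope ring_scope.

(* The complex numbers over R.  Going through numClosedFieldType is what gives
   them, and the spaces of row vectors over them, their topology. *)
Definition Cx (R : realType) : numClosedFieldType := complex R.

Section Calculus.
Context {R : realType} {m : nat}.
Local Notation C := (Cx R).
Local Notation vec := 'rV[C]_m.
Implicit Types (V : set vec) (f : vec -> C) (s X Y : vec -> vec).

Definition bvec (i : 'I_m) : vec := delta_mx 0 i.

(* Real-directional derivatives: C-valued functions of a real parameter are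
   differentiated through their real and imaginary parts. *)
Definition Re_line (v : vec) f (z : vec) (t : R) : R :=
  complex.Re (f (z + real_complex R t *: v) : complex R).
Definition Im_line (v : vec) f (z : vec) (t : R) : R :=
  complex.Im (f (z + real_complex R t *: v) : complex R).

Definition rderivable v f z : Prop :=
  derivable (Re_line v f z) 0 1 /\ derivable (Im_line v f z) 0 1.

Definition rderive v f z : C :=
  Complex (derive1 (Re_line v f z) 0) (derive1 (Im_line v f z) 0).

Fixpoint Cn (n : nat) V f : Prop :=
  {in V, continuous f} /\
  if n is k.+1 then
    forall v, (forall z, V z -> rderivable v f z) /\ Cn k V (rderive v f)
  else True.

Definition smooth V f : Prop := forall n, Cn n V f.

(* d/dz^i and d/d(conj z^i), for z^i = x^i + 'i y^i *)
Definition dz (i : 'I_m) f z : C :=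
  (rderive (bvec i) f z - 'i * rderive ('i *: bvec i) f z) / 2.
Definition dzbar (i : 'I_m) f z : C :=
  (rderive (bvec i) f z + 'i * rderive ('i *: bvec i) f z) / 2.

(* The Cauchy-Riemann definition of holomorphic functions of several variables;
   on open sets it agrees with complex differentiability. *)
Definition holo V f : Prop :=
  smooth V f /\ forall i z, V z -> dzbar i f z = 0.

(* A map s : vec -> vec stands for the field sum_k s^k d/dz^k: a section of the
   bundle of (1,0)-vectors in the coordinate frame. *)
Definition smooth_vec V s : Prop := forall k, smooth V (fun z => s z 0 k).
Definition holo_vec V s : Prop := forall k, holo V (fun z => s z 0 k).

Definition dzv i s z : vec := \row_k dz i (fun w => s w 0 k) z.
Definition dzbarv i s z : vec := \row_k dzbar i (fun w => s w 0 k) z.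

Definition der X f z : C := \sum_i X z 0 i * dz i f z.
Definition derv X Y z : vec := \sum_i X z 0 i *: dzv i Y z.

(* Bracket of fields of type (1,0), i.e. the Lie derivative L_X Y. *)
Definition lie X Y z : vec := derv X Y z - derv Y X z.

(* nabla_X Y for the (1,0)-connection with coefficients G:
   nabla_(d/dz^i) (d/dz^j) = G z (bvec i) (bvec j). *)
Definition covd (G : vec -> vec -> vec -> vec) X Y z : vec :=
  derv X Y z + G z (X z) (Y z).

End Calculus.

Record lchart (R : realType) (m : nat) (M : topologicalType) := LChart {
  dom : set M;
  img : set 'rV[Cx R]_m;
  fwd : M -> 'rV[Cx R]_m;
  bwd : 'rV[Cx R]_m -> M;
  open_dom : open dom;
  open_img : open img;
  fwd_img : forall p, dom p -> img (fwd p);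
  bwd_dom : forall z, img z -> dom (bwd z);
  fwdK : forall p, dom p -> bwd (fwd p) = p;
  bwdK : forall z, img z -> fwd (bwd z) = z;
  fwd_cont : {in dom, continuous fwd};
  bwd_cont : {in img, continuous bwd} }.

Section Charts.
Context {R : realType} {m : nat} {M : topologicalType}.
Implicit Types phi psi : lchart R m M.

Definition overlap phi psi : set 'rV[Cx R]_m :=
  [set z | img phi z /\ dom psi (bwd phi z)].

Definition trans phi psi : 'rV[Cx R]_m -> 'rV[Cx R]_m := fwd psi \o bwd phi.

(* On components of tangent vectors (row vectors), the change of coordinates
   from phi to psi is v |-> v *m jac phi psi z. *)
Definition jac phi psi (z : 'rV[Cx R]_m) : 'M[Cx R]_m :=
  \matrix_(i, k) dz i (fun w => trans phi psi w 0 k) z.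

Definition compatible phi psi : Prop :=
  holo_vec (overlap phi psi) (trans phi psi) /\
  holo_vec (overlap psi phi) (trans psi phi).

End Charts.

(* Second countability is not required: nothing here depends on it. *)
Record complex_manifold (R : realType) (m : nat) := ComplexManifold {
  carrier :> topologicalType;
  carrier_hausdorff : hausdorff_space carrier;
  atlas : set (lchart R m carrier);
  atlas_cover : forall p, exists2 phi, atlas phi & dom phi p;
  atlas_compatible : forall phi psi,
    atlas phi -> atlas psi -> compatible phi psi;
  (* so the charts of the atlas are all the holomorphic local coordinates *)
  atlas_maximal : forall phi,
    (forall psi, atlas psi -> compatible phi psi) -> atlas phi }.

(* Tensor fields are given by their components in all local coordinates: a field
   takes a chart phi and a point z of img phi; its values at charts
   outside the atlas or at points outside img phi are irrelevant. *)
Section Tensors.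
Context {R : realType} {m : nat} (M : complex_manifold R m).
Local Notation C := (Cx R).
Local Notation vec := 'rV[C]_m.
Local Notation chart := (lchart R m M).

Definition vfield_type := chart -> vec -> vec.
Definition form_type := chart -> vec -> vec -> vec -> C.
Definition bundle_map_type := chart -> vec -> vec -> vec.
Definition prod_type := chart -> vec -> vec -> vec -> vec.

Definition is_holo_vfield (X : vfield_type) : Prop :=
  (forall phi, atlas phi -> holo_vec (img phi) (X phi)) /\
  (forall phi psi z, atlas phi -> atlas psi -> overlap phi psi z ->
     X psi (trans phi psi z) = X phi z *m jac phi psi z).

Record is_holo_metric (g : form_type) : Prop := IsHoloMetric {
  metric_linear : forall phi z v, atlas phi -> img phi z ->
    scalar (g phi z v);
  metric_sym : forall phi z v w, atlas phi -> img phi z ->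
    g phi z v w = g phi z w v;
  metric_nondeg : forall phi z v, atlas phi -> img phi z ->
    (forall w, g phi z v w = 0) -> v = 0;
  metric_holo : forall phi i j, atlas phi ->
    holo (img phi) (fun z => g phi z (bvec i) (bvec j));
  metric_trans : forall phi psi z v w,
    atlas phi -> atlas psi -> overlap phi psi z ->
    g psi (trans phi psi z) (v *m jac phi psi z) (w *m jac phi psi z) =
    g phi z v w }.

Record is_holo_product (mu : prod_type) : Prop := IsHoloProduct {
  product_linear : forall phi z v, atlas phi -> img phi z ->
    linear (mu phi z v);
  product_comm : forall phi z v w, atlas phi -> img phi z ->
    mu phi z v w = mu phi z w v;
  product_assoc : forall phi z u v w, atlas phi -> img phi z ->
    mu phi z u (mu phi z v w) = mu phi z (mu phi z u v) w;
  product_holo : forall phi i j, atlas phi ->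
    holo_vec (img phi) (fun z => mu phi z (bvec i) (bvec j));
  product_trans : forall phi psi z v w,
    atlas phi -> atlas psi -> overlap phi psi z ->
    mu psi (trans phi psi z) (v *m jac phi psi z) (w *m jac phi psi z) =
    mu phi z v w *m jac phi psi z }.

(* A C^oo connection of type (1,0) on the bundle of (1,0)-vectors, given by its
   coefficients: D_X Y = covd (G phi) X Y in the chart phi. *)
Record is_connection10 (G : prod_type) : Prop := IsConnection10 {
  connection_linearl : forall phi z v, atlas phi -> img phi z ->
    linear (fun u => G phi z u v);
  connection_linearr : forall phi z v, atlas phi -> img phi z ->
    linear (G phi z v);
  connection_smooth : forall phi i j, atlas phi ->
    smooth_vec (img phi) (fun z => G phi z (bvec i) (bvec j));
  connection_trans : forall phi psi (X Y X' Y' : vec -> vec),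
    atlas phi -> atlas psi ->
    smooth_vec (overlap phi psi) X -> smooth_vec (overlap phi psi) Y ->
    smooth_vec (overlap psi phi) X' -> smooth_vec (overlap psi phi) Y' ->
    (forall z, overlap phi psi z ->
       X' (trans phi psi z) = X z *m jac phi psi z /\
       Y' (trans phi psi z) = Y z *m jac phi psi z) ->
    forall z, overlap phi psi z ->
      covd (G psi) X' Y' (trans phi psi z) =
      covd (G phi) X Y z *m jac phi psi z }.

Definition is_levi_civita (g : form_type) (G : prod_type) : Prop :=
  is_connection10 G /\
  forall phi, atlas phi ->
  (forall i j, holo_vec (img phi) (fun z => G phi z (bvec i) (bvec j))) /\
  forall (X Y Z : vec -> vec), holo_vec (img phi) X -> holo_vec (img phi) Y ->
    holo_vec (img phi) Z -> forall z, img phi z ->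
    [/\ covd (G phi) X Y z - covd (G phi) Y X z = lie X Y z &
        der X (fun w => g phi w (Y w) (Z w)) z =
          g phi z (covd (G phi) X Y z) (Z z) +
          g phi z (Y z) (covd (G phi) X Z z)].

Record is_antilinear_involution (kappa : bundle_map_type) : Prop :=
  IsAntilinearInvolution {
  kappa_antilinear : forall phi z a v w, atlas phi -> img phi z ->
    kappa phi z (a *: v + w) = a^* *: kappa phi z v + kappa phi z w;
  kappa_invol : forall phi z v, atlas phi -> img phi z ->
    kappa phi z (kappa phi z v) = v;
  kappa_smooth : forall phi i, atlas phi ->
    smooth_vec (img phi) (fun z => kappa phi z (bvec i));
  kappa_trans : forall phi psi z v,
    atlas phi -> atlas psi -> overlap phi psi z ->
    kappa psi (trans phi psi z) (v *m jac phi psi z) =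
    kappa phi z v *m jac phi psi z }.

End Tensors.

Section Frobenius.
Context {R : realType} {m : nat} {M : complex_manifold R m}.
Local Notation C := (Cx R).
Local Notation vec := 'rV[C]_m.
Local Notation sec := (vec -> vec).
Local Notation chart := (lchart R m M).

(* (nabla_Z c)(U, V, W), for c (U, V, W) = g (U o V, W) *)
Definition nabla_c (g : form_type M) (mu G : prod_type M) (phi : chart)
    (Z U V W : sec) (z : vec) : C :=
  let c (A B D : sec) w := g phi w (mu phi w (A w) (B w)) (D w) in
  let nab := covd (G phi) Z in
  der Z (c U V W) z - c (nab U) V W z - c U (nab V) W z - c U V (nab W) z.

Record is_frobenius (g : form_type M) (mu : prod_type M) (e E : vfield_type M)
    (d : C) (nabla : prod_type M) : Prop := IsFrobenius {
  frob_metric : is_holo_metric g;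
  frob_product : is_holo_product mu;
  frob_unit_holo : is_holo_vfield e;
  frob_euler_holo : is_holo_vfield E;
  frob_unit : forall phi z v, atlas phi -> img phi z -> mu phi z (e phi z) v = v;
  frob_levi_civita : is_levi_civita g nabla;
  frob_flat : forall phi (X Y Z : sec), atlas phi ->
    holo_vec (img phi) X -> holo_vec (img phi) Y -> holo_vec (img phi) Z ->
    forall z, img phi z ->
    let nab := covd (nabla phi) in
    nab X (nab Y Z) z - nab Y (nab X Z) z - nab (lie X Y) Z z = 0;
  frob_invariant : forall phi z u v w, atlas phi -> img phi z ->
    g phi z (mu phi z u v) w = g phi z u (mu phi z v w);
  frob_unit_flat : forall phi (X : sec), atlas phi -> holo_vec (img phi) X ->
    forall z, img phi z -> covd (nabla phi) X (e phi) z = 0;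
  (* adjacent transpositions generate the symmetries of the four arguments *)
  frob_c_sym : forall phi (Z U V W : sec), atlas phi ->
    holo_vec (img phi) Z -> holo_vec (img phi) U ->
    holo_vec (img phi) V -> holo_vec (img phi) W ->
    forall z, img phi z ->
    let T := nabla_c g mu nabla phi in
    [/\ T Z U V W z = T U Z V W z, T Z U V W z = T Z V U W z &
        T Z U V W z = T Z U W V z];
  frob_nabla2_euler : forall phi (X Y : sec), atlas phi ->
    holo_vec (img phi) X -> holo_vec (img phi) Y -> forall z, img phi z ->
    let nab := covd (nabla phi) in
    nab X (nab Y (E phi)) z - nab (nab X Y) (E phi) z = 0;
  frob_lie_product : forall phi (X Y : sec), atlas phi ->
    holo_vec (img phi) X -> holo_vec (img phi) Y -> forall z, img phi z ->
    lie (E phi) (fun w => mu phi w (X w) (Y w)) z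
      - mu phi z (lie (E phi) X z) (Y z) - mu phi z (X z) (lie (E phi) Y z) =
    mu phi z (X z) (Y z);
  frob_lie_metric : forall phi (X Y : sec), atlas phi ->
    holo_vec (img phi) X -> holo_vec (img phi) Y -> forall z, img phi z ->
    der (E phi) (fun w => g phi w (X w) (Y w)) z
      - g phi z (lie (E phi) X z) (Y z) - g phi z (X z) (lie (E phi) Y z) =
    (2 - d) * g phi z (X z) (Y z) }.

Definition canonical_coords (mu : prod_type M) (phi : chart) : Prop :=
  atlas phi /\
  forall z a b, img phi z -> mu phi z (bvec a) (bvec b) = bvec a *+ (a == b).

Definition semisimple (mu : prod_type M) : Prop :=
  forall p : M, exists2 phi, canonical_coords mu phi & dom phi p.

Definition flat_coordinates (nabla : prod_type M) (phi : chart) : Prop :=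
  atlas phi /\
  forall i (X : sec), holo_vec (img phi) X ->
    forall z, img phi z -> covd (nabla phi) X (fun=> bvec i) z = 0.

Definition potential (g : form_type M) (mu : prod_type M) (phi : chart)
    (F : vec -> C) : Prop :=
  holo (img phi) F /\
  forall i j k z, img phi z ->
    dz i (dz j (dz k F)) z = g phi z (mu phi z (bvec i) (bvec j)) (bvec k).

(* In dimension 0 every polynomial is constant, whence the proviso on the
   degree. *)
Definition trivial_frobenius (g : form_type M) (mu nabla : prod_type M) : Prop :=
  forall p : M, exists phi F (P : mpoly.mpoly m C),
    [/\ dom phi p, flat_coordinates nabla phi, potential g mu phi F,
        forall z, img phi z -> F z = mpoly.meval (fun i => z 0 i) P &
        (0 < m)%N ->
          (\max_(a <- mpoly.msupp P) mpoly.mdeg a)%N = 3%N].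

End Frobenius.

Section CV.
Context {R : realType} {m : nat}.
Local Notation C := (Cx R).
Local Notation vec := 'rV[C]_m.
Local Notation sec := (vec -> vec).
Local Notation op := (sec -> sec).
(* An operator-valued 1-form: inl i and inr i index its components along
   d/dz^i and d/d(conj z^i). *)
Local Notation opform := ('I_m + 'I_m -> op).

Definition form10 (A : 'I_m -> op) : opform :=
  fun a => match a with inl i => A i | inr _ => 0 end.
Definition form01 (A : 'I_m -> op) : opform :=
  fun a => match a with inl _ => 0 | inr i => A i end.

(* The product of two operator-valued 1-forms, evaluated on a pair of
   coordinate fields; as these commute, this applies to connections too. *)
Definition wedge (A B : opform) (a b : 'I_m + 'I_m) : op :=
  (A a \o B b) - (A b \o B a).

Definition comm1 (A : opform) (u : op) (a : 'I_m + 'I_m) : op :=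
  (A a \o u) - (u \o A a).

Definition eqop (V : set vec) (A B : op) : Prop :=
  forall s, smooth_vec V s -> forall z, V z -> A s z = B s z.
Definition eqform1 V (A B : opform) : Prop := forall a, eqop V (A a) (B a).
Definition eqform2 V (A B : 'I_m + 'I_m -> opform) : Prop :=
  forall a b, eqop V (A a b) (B a b).

Definition fiberwise (f : vec -> vec -> vec) : op := fun s z => f z (s z).

(* The CV-structure axioms over an open subset V of C^m, where D1 i, D2 i, CC i
   and Ct i are the components of D', D'', C and tilde C. *)
Record is_CV (V : set vec) (D1 D2 CC Ct : 'I_m -> op)
    (kappa : vec -> vec -> vec) (h : vec -> vec -> vec -> C) (U Q : op) : Prop :=
  IsCV {
  cv_C_D2_sq :
    let P := form10 CC + form01 D2 in eqform2 V (wedge P P) 0;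
  cv_Ct_D1_sq :
    let P := form01 Ct + form10 D1 in eqform2 V (wedge P P) 0;
  cv_D1_C :
    eqform2 V (wedge (form10 D1) (form10 CC) + wedge (form10 CC) (form10 D1)) 0;
  cv_D2_Ct :
    eqform2 V (wedge (form01 D2) (form01 Ct) + wedge (form01 Ct) (form01 D2)) 0;
  cv_curvature :
    eqform2 V (wedge (form10 D1) (form01 D2) + wedge (form01 D2) (form10 D1))
      (- (wedge (form10 CC) (form01 Ct) + wedge (form01 Ct) (form10 CC)));
  cv_kappa_sq : forall z v, V z -> kappa z (kappa z v) = v;
  cv_D_kappa : forall i,
    eqop V (D1 i \o fiberwise kappa) (fiberwise kappa \o D2 i) /\
    eqop V (D2 i \o fiberwise kappa) (fiberwise kappa \o D1 i);
  cv_kappa_C : forall i,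
    eqop V (fiberwise kappa \o CC i \o fiberwise kappa) (Ct i);
  cv_h_linear : forall z a u v w, V z ->
    h z (a *: u + v) w = a * h z u w + h z v w;
  cv_h_semilinear : forall z a u v w, V z ->
    h z w (a *: u + v) = a^* * h z w u + h z w v;
  cv_h_nondeg : forall z v, V z -> (forall w, h z v w = 0) -> v = 0;
  cv_h_herm : forall z v w, V z -> h z w v = (h z v w)^*;
  cv_h_real : forall z v w, V z -> kappa z v = v -> kappa z w = w ->
    h z v w \is Num.real;
  cv_h_C : forall i s t, smooth_vec V s -> smooth_vec V t -> forall z, V z ->
    h z (CC i s z) (t z) = h z (s z) (Ct i t z);
  cv_D_h : forall i s t, smooth_vec V s -> smooth_vec V t -> forall z, V z ->
    dz i (fun w => h w (s w) (t w)) z =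
      h z (D1 i s z) (t z) + h z (s z) (D2 i t z) /\
    dzbar i (fun w => h w (s w) (t w)) z =
      h z (D2 i s z) (t z) + h z (s z) (D1 i t z);
  cv_C_U : eqform1 V (comm1 (form10 CC) U) 0;
  cv_D1_U :
    eqform1 V (comm1 (form10 D1) U - comm1 (form10 CC) Q + form10 CC) 0;
  cv_D2_U : eqform1 V (comm1 (form01 D2) U) 0;
  cv_D1_Q :
    eqform1 V (comm1 (form10 D1) Q +
               comm1 (form10 CC) (fiberwise kappa \o U \o fiberwise kappa)) 0;
  cv_kappa_Q : eqop V ((fiberwise kappa \o Q \o fiberwise kappa) + Q) 0;
  cv_h_U : forall s t, smooth_vec V s -> smooth_vec V t -> forall z, V z ->
    h z (U s z) (t z) =
    h z (s z) ((fiberwise kappa \o U \o fiberwise kappa) t z);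
  cv_h_Q : forall s t, smooth_vec V s -> smooth_vec V t -> forall z, V z ->
    h z (Q s z) (t z) = h z (s z) (Q t z) }.

End CV.

Section CDV.
Context {R : realType} {m : nat} {M : complex_manifold R m}.
Local Notation C := (Cx R).
Local Notation vec := 'rV[C]_m.
Local Notation sec := (vec -> vec).
Local Notation op := (sec -> sec).
Local Notation chart := (lchart R m M).

Definition herm (g : form_type M) (kappa : bundle_map_type M) : form_type M :=
  fun phi z v w => g phi z v (kappa phi z w).

(* D' + dbar is the Chern connection of h; D' determines it. *)
Definition is_chern (h : form_type M) (D' : prod_type M) : Prop :=
  is_connection10 D' /\
  forall phi, atlas phi ->
  forall i (s t : sec), smooth_vec (img phi) s -> smooth_vec (img phi) t ->
  forall z, img phi z ->
    dz i (fun w => h phi w (s w) (t w)) z =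
      h phi z (covd (D' phi) (fun=> bvec i) s z) (t z) +
      h phi z (s z) (dzbarv i t z) /\
    dzbar i (fun w => h phi w (s w) (t w)) z =
      h phi z (dzbarv i s z) (t z) +
      h phi z (s z) (covd (D' phi) (fun=> bvec i) t z).

Definition Higgs (mu : prod_type M) (phi : chart) (i : 'I_m) : op :=
  fun s z => - mu phi z (bvec i) (s z).

Definition Uop (mu : prod_type M) (E : vfield_type M) (phi : chart) : op :=
  fun s z => mu phi z (E phi z) (s z).

(* E being of type (1,0), D_E only involves D'. *)
Definition Qop (E : vfield_type M) (d : C) (D' : prod_type M) (phi : chart) : op :=
  fun s z => covd (D' phi) (E phi) s z - lie (E phi) s z - ((2 - d) / 2) *: s z.

Record is_CDV (g : form_type M) (mu : prod_type M) (e E : vfield_type M) (d : C)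
    (kappa : bundle_map_type M) (D' : prod_type M) : Prop := IsCDV {
  cdv_kappa : is_antilinear_involution kappa;
  cdv_chern : is_chern (herm g kappa) D';
  cdv_d_real : d \is Num.real;
  cdv_D_unit : forall phi z, atlas phi -> img phi z ->
    covd (D' phi) (e phi) (e phi) z = 0;
  cdv_CV : forall phi, atlas phi ->
    is_CV (img phi)
      (fun i => covd (D' phi) (fun=> bvec i)) dzbarv
      (Higgs mu phi)
      (fun i => fiberwise (kappa phi) \o Higgs mu phi i \o fiberwise (kappa phi))
      (kappa phi) (herm g kappa phi) (Uop mu E phi) (Qop E d D' phi) }.

Definition pos_def (h : form_type M) : Prop :=
  forall phi z v, atlas phi -> img phi z -> v != 0 -> 0 < h phi z v v.

(* The (0,1)-operator dbar along the conjugate of the (1,0)-field X. *)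
Definition dbar_conj (X s : sec) (z : vec) : vec :=
  \sum_i (X z 0 i)^* *: dzbarv i s z.

Definition kappa_flat (nabla : prod_type M) (kappa : bundle_map_type M) : Prop :=
  forall phi, atlas phi -> forall X : sec, smooth_vec (img phi) X ->
    eqop (img phi) (covd (nabla phi) X \o fiberwise (kappa phi))
                   (fiberwise (kappa phi) \o dbar_conj X) /\
    eqop (img phi) (dbar_conj X \o fiberwise (kappa phi))
                   (fiberwise (kappa phi) \o covd (nabla phi) X).

Definition same_connection (D1 D2 : prod_type M) : Prop :=
  forall phi, atlas phi -> forall X : sec, smooth_vec (img phi) X ->
    eqop (img phi) (covd (D1 phi) X) (covd (D2 phi) X).

Definition eta_of (g : form_type M) (phi : chart) (z : vec) (a : 'I_m) : C :=
  g phi z (bvec a) (bvec a).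

End CDV.

(* Main.v *)
Require Import Defs.
From HB Require Import structures.
From mathcomp Require Import all_boot all_order all_algebra complex.
From mathcomp Require mpoly.
From mathcomp Require Import all_classical all_reals all_analysis.
From mathcomp Require Import ring.
Import Order.TTheory GRing.Theory Num.Theory numFieldNormedType.Exports.

Set Implicit Arguments.
Unset Strict Implicit.
Unset Printing Implicit Defensive.

Local Open Scope classical_set_scope.
Local Open Scope ring_scope.

(** The difference of two connections is tensorial, so [D' = nabla] and the
    flatness of [kappa] can both be read off on constant sections; since
    [D'] always satisfies [D' kappa = kappa dbar], each of the two statements
    gives the other ([kappa_flatP]).

    Assume from now on that [D' = nabla].  Write [x o y] for the product, [e]
    for its unit and [C~ = kappa C kappa] for the conjugate Higgs field.  The
    key point is that the product is then [nabla]-parallel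
    ([product_parallel]):
    - [nabla] is holomorphic, so its curvature with [dbar] vanishes, and the
      equation [D'D'' + D''D' = - (C C~ + C~ C)] says that every
      multiplication commutes with every component of [C~];
    - [(C~ + D')^2 = 0] says that [nabla] commutes with every component of
      [C~]; by the Jacobi identity the endomorphism [[nabla_i, x o]] commutes
      with them too;
    - an operator [kappa (u o) kappa] that commutes with all multiplications
      is itself a multiplication, and the resulting antilinear map
      [u |-> kappa (u o kappa e)] is an involution, so all multiplications
      have this form ([mu_is_kappa_mu_kappa]).  Hence [[nabla_i, x o]] commutes
      with all multiplications and is the multiplication by its value
      [nabla_i x] at the flat field [e].

    Semi-simplicity enters through the fact that an algebra spanned by
    idempotents has no nonzero derivation ([derivation0]).  In canonical
    coordinates the structure constants of the product are constant, so a
    parallel product makes each [nabla_u] a pointwise derivation, and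
    [nabla = 0] in these coordinates ([canonical_nabla0]).  In any coordinates
    [L_E(o) = o] together with the parallel product makes [nabla E - Id] a
    derivation, so [nabla E = Id] and [Q = (d / 2) Id]; as [d] is real,
    [kappa Q kappa = - Q] forces [Q = 0] ([Qop0]).

    The functions [eta_a = g(d/du^a, d/du^a)] have zero derivatives, so on a
    polydisc they are constant and [sum_a (eta_a / 6) (u^a)^3] is a potential
    ([semisimple_trivial]).

    Finally [kappa (c o) kappa] commutes with multiplication by [a], so for
    [a <> c] the vector [x = c o kappa a] (with [a], [c] canonical idempotents)
    lies on the line of [c] while [kappa x] lies on that of [a]; these lines
    are [g]-orthogonal, so [h(x, x) = 0] and [x = 0] when [h] is positive.
    Thus [kappa] preserves each canonical line ([canonical_kappa]). *)

(** * Derivatives along real directions *)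

Section RealDerivative.
Context {R : realType} {m : nat}.
Local Notation C := (Cx R).
Local Notation vec := 'rV[C]_m.
Local Notation Re := (@complex.Re R).
Local Notation Im := (@complex.Im R).
Implicit Types (V W : set vec) (f g : vec -> C) (z v : vec) (a b l : C).

Lemma normc_real (t : R) : `|real_complex R t : C| = real_complex R `|t|.
Proof. by rewrite [LHS]normc_def /= expr0n addr0 sqrtr_sqr. Qed.

Lemma posc_real a : 0 < a -> exists2 t : R, 0 < t & a = real_complex R t.
Proof. by case: a => x y; rewrite ltcE /= => /andP[/eqP -> x0]; exists x. Qed.

Lemma continuous_real_complex : continuous (real_complex R : R -> C).
Proof.
move=> t; apply/cvgrPdist_lt => eps /posc_real [d d0 ->].
near=> s; rewrite -raddfB normc_real ltcR.
by near: s; apply: (@cvgr_dist_lt _ _ _ (nbhs t) _ id t).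
Unshelve. all: by end_near. Qed.

Lemma continuous_line z v :
  continuous (fun t : R => z + real_complex R t *: v : vec).
Proof.
move=> t; apply: cvgD; first exact: cvg_cst.
by apply: cvgZr_tmp; exact: continuous_real_complex.
Qed.

Lemma near_line V z v : open V -> V z ->
  \forall t \near (0 : R), V (z + real_complex R t *: v).
Proof.
move=> oV Vz; have := @continuous_line z v 0.
rewrite /continuous_at raddf0 scale0r addr0; apply.
by rewrite nbhs_nearE; exact: open_nbhs_nbhs.
Qed.

(** Pairing derivability with a value lets the calculus rules for real functions
    be applied to the real and imaginary parts in one go. *)
Definition is_rder v f z l : Prop :=
  is_derive (0 : R) 1 (Re_line v f z) (Re l) /\
  is_derive (0 : R) 1 (Im_line v f z) (Im l).

Lemma rderiveP v f z : rderivable v f z -> is_rder v f z (rderive v f z).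
Proof.
by case=> /derivableP dR /derivableP dI; split; rewrite /= derive1E.
Qed.

Lemma is_rder_derivable v f z l : is_rder v f z l -> rderivable v f z.
Proof. by move=> [fR fI]; split; [case: fR|case: fI]. Qed.

Lemma is_rder_val v f z l : is_rder v f z l -> rderive v f z = l.
Proof.
by case: l => x y -[dR dI]; rewrite /rderive !derive1E !derive_val.
Qed.

Lemma is_rder_local V v f g z l : open V -> V z -> {in V, f =1 g} ->
  is_rder v f z l -> is_rder v g z l.
Proof.
move=> oV Vz fg [dR dI]; split; [move: dR|move: dI];
  apply: near_eq_is_derive; near=> t; rewrite /Re_line /Im_line fg //;
  by apply/mem_set; near: t; apply: near_line.
Unshelve. all: by end_near. Qed.

Lemma is_rder_cst v a z : is_rder v (fun=> a) z 0.
Proof. by split; exact: is_derive_cst. Qed.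

Lemma is_rderD v f g z a b : is_rder v f z a -> is_rder v g z b ->
  is_rder v (fun w => f w + g w) z (a + b).
Proof.
have DRe (c d : C) : Re (c + d) = Re c + Re d by case: c d => ? ? [].
have DIm (c d : C) : Im (c + d) = Im c + Im d by case: c d => ? ? [].
move=> [fR fI] [gR gI]; split.
  rewrite DRe (_ : Re_line _ _ _ = Re_line v f z + Re_line v g z).
    exact: is_deriveD.
  by apply/funext => t; rewrite /Re_line DRe.
rewrite DIm (_ : Im_line _ _ _ = Im_line v f z + Im_line v g z).
  exact: is_deriveD.
by apply/funext => t; rewrite /Im_line DIm.
Qed.

Lemma is_rderM v f g z a b : is_rder v f z a -> is_rder v g z b ->
  is_rder v (fun w => f w * g w) z (a * g z + f z * b).
Proof.
have DRe (c d : C) : Re (c + d) = Re c + Re d by case: c d => ? ? [].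
have DIm (c d : C) : Im (c + d) = Im c + Im d by case: c d => ? ? [].
have MRe (c d : C) : Re (c * d) = Re c * Re d - Im c * Im d.
  by case: c d => ? ? [].
have MIm (c d : C) : Im (c * d) = Re c * Im d + Im c * Re d.
  by case: c d => ? ? [].
have z0 : z + real_complex R 0 *: v = z by rewrite raddf0 scale0r addr0.
have R0 k : Re_line v k z 0 = Re (k z) by rewrite /Re_line z0.
have I0 k : Im_line v k z 0 = Im (k z) by rewrite /Im_line z0.
move=> [fR fI] [gR gI]; split.
  rewrite (_ : Re_line _ _ _ = Re_line v f z * Re_line v g z
                               - Im_line v f z * Im_line v g z); last first.
    by apply/funext => t; rewrite /Re_line MRe.
  have := is_deriveB (is_deriveM fR gR) (is_deriveM fI gI).
  move/is_derive_eq; apply; rewrite DRe !MRe !R0 !I0 /GRing.scale /=.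
  by ring.
rewrite (_ : Im_line _ _ _ = Re_line v f z * Im_line v g z
                             + Im_line v f z * Re_line v g z); last first.
  by apply/funext => t; rewrite /Im_line MIm.
have := is_deriveD (is_deriveM fR gI) (is_deriveM fI gR).
move/is_derive_eq; apply; rewrite DIm !MIm !R0 !I0 /GRing.scale /=.
by ring.
Qed.

Lemma is_rder_conj v f z l : is_rder v f z l ->
  is_rder v (fun w => (f w)^*) z l^*.
Proof.
have CRe c : Re (c^*) = Re c by case: c.
have CIm c : Im (c^*) = - Im c by case: c.
move=> [fR fI]; split.
  rewrite CRe (_ : Re_line _ _ _ = Re_line v f z) //.
  by apply/funext => t; rewrite /Re_line CRe.
rewrite CIm (_ : Im_line _ _ _ = - Im_line v f z); first exact: is_deriveN.
by apply/funext => t; rewrite /Im_line CIm.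
Qed.

Lemma is_rder_coord v i z : is_rder v (fun w => w 0 i) z (v 0 i).
Proof.
have affine (a b : R) : is_derive (0 : R) (1 : R) (cst a + b *: id) b.
  have := is_deriveD (is_derive_cst a (0 : R) (1 : R))
            (is_deriveZ b (is_derive_id (0 : R) (1 : R))).
  by move/is_derive_eq; apply; rewrite add0r; exact: mulr1.
split.
  rewrite (_ : Re_line _ _ _ = cst (Re (z 0 i)) + Re (v 0 i) *: id).
    exact: affine.
  apply/funext => t; rewrite /Re_line !mxE !fctE /GRing.scale /=.
  by case: (z 0 i) (v 0 i) => ? ? [? ?] /=; rewrite mul0r subr0 mulrC.
rewrite (_ : Im_line _ _ _ = cst (Im (z 0 i)) + Im (v 0 i) *: id).
  exact: affine.
apply/funext => t; rewrite /Im_line !mxE !fctE /GRing.scale /=.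
by case: (z 0 i) (v 0 i) => ? ? [? ?] /=; rewrite mul0r addr0 mulrC.
Qed.

End RealDerivative.

(** * Smooth and holomorphic functions *)

Lemma continuous_conjC (K : numClosedFieldType) : continuous (Num.conj : K -> K).
Proof.
move=> a; apply/(@cvgrPdist_lt K K K (nbhs a) (nbhs_filter a)) => eps e0.
have near_a : \forall b \near a, `|a - b| < eps.
  by apply: (@cvgr_dist_lt K K K (nbhs a) (nbhs_filter a) id a).
by apply: filterS near_a => b; rewrite -rmorphB norm_conjC.
Qed.

Lemma leibniz_comb (K : comNzRingType) (j h f g a b a' b' : K) :
  (a * g + f * b + j * (a' * g + f * b')) * h =
  (a + j * a') * h * g + f * ((b + j * b') * h).
Proof. by ring. Qed.

Section Smooth.
Context {R : realType} {m : nat}.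
Local Notation C := (Cx R).
Local Notation vec := 'rV[C]_m.
Implicit Types (V W : set vec) (f g : vec -> C) (z v : vec) (a b l : C).

Definition rdiff f z : Prop := forall v, rderivable v f z.

Lemma rdiff_is_rder v f z : rdiff f z -> is_rder v f z (rderive v f z).
Proof. by move=> df; exact: rderiveP. Qed.

Lemma rdiff_cst a z : rdiff (fun=> a) z.
Proof. by move=> v; exact: is_rder_derivable (is_rder_cst v a z). Qed.

Lemma rdiffD f g z : rdiff f z -> rdiff g z -> rdiff (fun w => f w + g w) z.
Proof.
move=> df dg v; apply: is_rder_derivable.
exact: is_rderD (rdiff_is_rder v df) (rdiff_is_rder v dg).
Qed.

Lemma rdiffM f g z : rdiff f z -> rdiff g z -> rdiff (fun w => f w * g w) z.
Proof.
move=> df dg v; apply: is_rder_derivable.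
exact: is_rderM (rdiff_is_rder v df) (rdiff_is_rder v dg).
Qed.

Lemma sum_fun_nil (I : Type) (F : I -> vec -> C) :
  (fun w => \sum_(k <- [::]) F k w) = fun=> 0.
Proof. by apply/funext=> w; rewrite big_nil. Qed.

Lemma sum_fun_cons (I : Type) (F : I -> vec -> C) k s :
  (fun w => \sum_(j <- k :: s) F j w) =
  (fun w => F k w + \sum_(j <- s) F j w).
Proof. by apply/funext=> w; rewrite big_cons. Qed.

Lemma rdiff_sum (I : Type) (s : seq I) (F : I -> vec -> C) z :
  (forall k, rdiff (F k) z) -> rdiff (fun w => \sum_(k <- s) F k w) z.
Proof.
move=> dF; elim: s => [|k s IH].
  by rewrite sum_fun_nil; exact: rdiff_cst.
by rewrite sum_fun_cons; exact: rdiffD (dF k) IH.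
Qed.

Lemma rdiff_coord i z : rdiff (fun w => w 0 i) z.
Proof. by move=> v; exact: is_rder_derivable (is_rder_coord v i z). Qed.

Lemma Cn_sub n V W f : V `<=` W -> Cn n W f -> Cn n V f.
Proof.
move=> VW; have cont (h : vec -> C) : {in W, continuous h} -> {in V, continuous h}.
  by move=> ch z /set_mem/VW/mem_set; exact: ch.
elim: n f => [|n IH] f [cf df]; first by split; first exact: cont cf.
split; first exact: cont cf.
by move=> v; have [dfv cv] := df v; split=> [z /VW|]; [exact: dfv|exact: IH].
Qed.

Lemma rderive_local V v f g z : open V -> V z -> {in V, f =1 g} ->
  rderive v f z = rderive v g z.
Proof.
move=> oV Vz fg; rewrite /rderive !derive1E; congr Complex;
  apply: near_eq_derive; near=> t; rewrite /Re_line /Im_line fg //;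
  by apply/mem_set; near: t; apply: near_line.
Unshelve. all: by end_near. Qed.

Lemma Cn_local n V f g : open V -> {in V, f =1 g} -> Cn n V f -> Cn n V g.
Proof.
move=> oV.
have cont (h k : vec -> C) :
    {in V, h =1 k} -> {in V, continuous h} -> {in V, continuous k}.
  move=> hk ch z Vz; rewrite /continuous_at -(hk _ Vz).
  have eqhk : \forall w \near z, h w = k w.
    near=> w; apply: hk; apply/mem_set; near: w.
    by apply: open_nbhs_nbhs; split=> //; exact: set_mem.
  exact: cvg_trans (near_eq_cvg eqhk) (ch z Vz).
elim: n f g => [|n IH] f g fg [cf df]; first by split; first exact: cont fg cf.
split; first exact: cont fg cf.
move=> v; have [dfv cv] := df v; split=> [z Vz|].
  exact: is_rder_derivable (is_rder_local oV Vz fg (rderiveP (dfv z Vz))).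
by apply: IH cv => z /set_mem Vz; exact: rderive_local fg.
Unshelve. all: by end_near. Qed.

Lemma CnS n V f : Cn n.+1 V f -> Cn n V f.
Proof.
elim: n f => [|n IH] f [cf df]; first by split.
split; first exact: cf.
by move=> v; have [dfv cv] := df v; split; [exact: dfv|exact: IH cv].
Qed.

Lemma Cn_cst n V a : Cn n V (fun=> a).
Proof.
have cont b : {in V, continuous (fun _ : vec => b)}.
  by move=> z _; exact: cst_continuous.
elim: n a => [|n IH] a; first by split; first exact: cont.
split; first exact: cont.
move=> v; split=> [z _|]; first exact: rdiff_cst.
rewrite (_ : rderive _ _ = fun=> 0) //.
by apply/funext=> z; exact: is_rder_val (is_rder_cst _ _ _).
Qed.

Lemma CnD n V f g : open V -> Cn n V f -> Cn n V g ->
  Cn n V (fun w => f w + g w).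
Proof.
move=> oV.
have cont (h k : vec -> C) : {in V, continuous h} -> {in V, continuous k} ->
    {in V, continuous (fun w => h w + k w)}.
  by move=> ch ck z Vz; exact: continuousD (ch z Vz) (ck z Vz).
elim: n f g => [|n IH] f g [cf df] [cg dg].
  by split; first exact: cont cf cg.
split; first exact: cont cf cg.
move=> v; have [dfv cfv] := df v; have [dgv cgv] := dg v.
have dfg z : V z ->
    is_rder v (fun w => f w + g w) z (rderive v f z + rderive v g z).
  by move=> Vz; apply: is_rderD; apply: rderiveP; [exact: dfv|exact: dgv].
split=> [z Vz|]; first exact: is_rder_derivable (dfg z Vz).
apply: Cn_local (IH _ _ cfv cgv) => // z /set_mem Vz.
by rewrite (is_rder_val (dfg z Vz)).
Qed.

Lemma CnM n V f g : open V -> Cn n V f -> Cn n V g ->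
  Cn n V (fun w => f w * g w).
Proof.
move=> oV.
have cont (h k : vec -> C) : {in V, continuous h} -> {in V, continuous k} ->
    {in V, continuous (fun w => h w * k w)}.
  by move=> ch ck z Vz; exact: continuousM (ch z Vz) (ck z Vz).
elim: n f g => [|n IH] f g Cf Cg.
  by have [[cf _] [cg _]] := (Cf, Cg); split; first exact: cont cf cg.
have [Cf' Cg'] := (CnS Cf, CnS Cg).
have [[cf df] [cg dg]] := (Cf, Cg); split; first exact: cont cf cg.
move=> v; have [dfv cfv] := df v; have [dgv cgv] := dg v.
have dfg z : V z -> is_rder v (fun w => f w * g w) z
    (rderive v f z * g z + f z * rderive v g z).
  by move=> Vz; apply: is_rderM; apply: rderiveP; [exact: dfv|exact: dgv].
split=> [z Vz|]; first exact: is_rder_derivable (dfg z Vz).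
apply: (@Cn_local _ _ (fun z => rderive v f z * g z + f z * rderive v g z)) => //.
  by move=> z /set_mem Vz; rewrite (is_rder_val (dfg z Vz)).
by apply: CnD => //; apply: IH.
Qed.

Lemma Cn_conj n V f : open V -> Cn n V f -> Cn n V (fun w => (f w)^*).
Proof.
move=> oV.
have cont (h : vec -> C) :
    {in V, continuous h} -> {in V, continuous (fun w => (h w)^*)}.
  by move=> ch z Vz; apply: (continuous_comp (ch z Vz)); exact: continuous_conjC.
elim: n f => [|n IH] f [cf df]; first by split; first exact: cont cf.
split; first exact: cont cf.
move=> v; have [dfv cfv] := df v.
have dfg z : V z -> is_rder v (fun w => (f w)^*) z (rderive v f z)^*.
  by move=> Vz; apply: is_rder_conj; apply: rderiveP; exact: dfv.
split=> [z Vz|]; first exact: is_rder_derivable (dfg z Vz).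
apply: Cn_local (IH _ cfv) => // z /set_mem Vz.
by rewrite (is_rder_val (dfg z Vz)).
Qed.

Lemma smooth_sub V W f : V `<=` W -> smooth W f -> smooth V f.
Proof. by move=> VW sf n; exact: Cn_sub VW (sf n). Qed.

Lemma smooth_local V f g : open V -> {in V, f =1 g} -> smooth V f -> smooth V g.
Proof. by move=> oV fg sf n; exact: Cn_local fg (sf n). Qed.

Lemma smooth_cst V a : smooth V (fun=> a).
Proof. by move=> n; exact: Cn_cst. Qed.

Lemma smoothD V f g : open V -> smooth V f -> smooth V g ->
  smooth V (fun w => f w + g w).
Proof. by move=> oV sf sg n; exact: CnD. Qed.

Lemma smoothM V f g : open V -> smooth V f -> smooth V g ->
  smooth V (fun w => f w * g w).
Proof. by move=> oV sf sg n; exact: CnM. Qed.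

Lemma smooth_conj V f : open V -> smooth V f -> smooth V (fun w => (f w)^*).
Proof. by move=> oV sf n; exact: Cn_conj. Qed.

Lemma smooth_sum V (I : Type) (s : seq I) (F : I -> vec -> C) : open V ->
  (forall k, smooth V (F k)) -> smooth V (fun w => \sum_(k <- s) F k w).
Proof.
move=> oV sF; elim: s => [|k s IH].
  by rewrite sum_fun_nil; exact: smooth_cst.
by rewrite sum_fun_cons; exact: smoothD (sF k) IH.
Qed.

Lemma smooth_coord V i : smooth V (fun w => w 0 i).
Proof.
have cont : {in V, continuous (fun w : vec => w 0 i)}.
  by move=> z _; exact: coord_continuous.
case=> [|n]; first by split.
split=> //.
move=> v; split=> [z _|]; first exact: rdiff_coord.
rewrite (_ : rderive _ _ = fun=> v 0 i); first exact: Cn_cst.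
by apply/funext=> z; exact: is_rder_val (is_rder_coord _ _ _).
Qed.

Lemma smooth_rdiff V f z : smooth V f -> V z -> rdiff f z.
Proof. by move=> /(_ 1%N)[_ df] Vz v; have [dfv _] := df v; exact: dfv. Qed.

Lemma dz_local V i f g z : open V -> V z -> {in V, f =1 g} ->
  dz i f z = dz i g z.
Proof. by move=> oV Vz fg; rewrite /dz !(rderive_local _ oV Vz fg). Qed.

Lemma dzbar_local V i f g z : open V -> V z -> {in V, f =1 g} ->
  dzbar i f z = dzbar i g z.
Proof. by move=> oV Vz fg; rewrite /dzbar !(rderive_local _ oV Vz fg). Qed.

Lemma dz_cst i a z : dz i (fun=> a) z = 0.
Proof. by rewrite /dz !(is_rder_val (is_rder_cst _ _ _)) mulr0 subr0 mul0r. Qed.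

Lemma dzbar_cst i a z : dzbar i (fun=> a) z = 0.
Proof. by rewrite /dzbar !(is_rder_val (is_rder_cst _ _ _)) mulr0 addr0 mul0r. Qed.

Lemma dzD i f g z : rdiff f z -> rdiff g z ->
  dz i (fun w => f w + g w) z = dz i f z + dz i g z.
Proof.
move=> df dg; rewrite /dz.
rewrite !(is_rder_val (is_rderD (rdiff_is_rder _ df) (rdiff_is_rder _ dg))).
by rewrite -mulrDl mulrDr opprD addrACA.
Qed.

Lemma dzbarD i f g z : rdiff f z -> rdiff g z ->
  dzbar i (fun w => f w + g w) z = dzbar i f z + dzbar i g z.
Proof.
move=> df dg; rewrite /dzbar.
rewrite !(is_rder_val (is_rderD (rdiff_is_rder _ df) (rdiff_is_rder _ dg))).
by rewrite -mulrDl mulrDr addrACA.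
Qed.

Lemma dzM i f g z : rdiff f z -> rdiff g z ->
  dz i (fun w => f w * g w) z = dz i f z * g z + f z * dz i g z.
Proof.
move=> df dg; rewrite /dz.
rewrite !(is_rder_val (is_rderM (rdiff_is_rder _ df) (rdiff_is_rder _ dg))).
by rewrite -!mulNr leibniz_comb.
Qed.

Lemma dzbarM i f g z : rdiff f z -> rdiff g z ->
  dzbar i (fun w => f w * g w) z = dzbar i f z * g z + f z * dzbar i g z.
Proof.
move=> df dg; rewrite /dzbar.
rewrite !(is_rder_val (is_rderM (rdiff_is_rder _ df) (rdiff_is_rder _ dg))).
by rewrite leibniz_comb.
Qed.

Lemma dz_sum i (I : Type) (s : seq I) (F : I -> vec -> C) z :
  (forall k, rdiff (F k) z) ->
  dz i (fun w => \sum_(k <- s) F k w) z = \sum_(k <- s) dz i (F k) z.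
Proof.
move=> dF; elim: s => [|k s IH].
  by rewrite sum_fun_nil big_nil dz_cst.
by rewrite sum_fun_cons big_cons -IH dzD //; exact: rdiff_sum.
Qed.

Lemma dzbar_sum i (I : Type) (s : seq I) (F : I -> vec -> C) z :
  (forall k, rdiff (F k) z) ->
  dzbar i (fun w => \sum_(k <- s) F k w) z = \sum_(k <- s) dzbar i (F k) z.
Proof.
move=> dF; elim: s => [|k s IH].
  by rewrite sum_fun_nil big_nil dzbar_cst.
by rewrite sum_fun_cons big_cons -IH dzbarD //; exact: rdiff_sum.
Qed.

Lemma dz_coord i k z : dz i (fun w => w 0 k) z = (i == k)%:R.
Proof.
rewrite /dz !(is_rder_val (is_rder_coord _ _ _)) !mxE eqxx /= (eq_sym k).
rewrite mulrA -expr2 sqrCi mulN1r opprK -mulr2n -[_ *+ 2]mulr_natr.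
by rewrite mulfK // pnatr_eq0.
Qed.

Lemma dzbar_coord i k z : dzbar i (fun w => w 0 k) z = 0.
Proof.
rewrite /dzbar !(is_rder_val (is_rder_coord _ _ _)) !mxE eqxx /= (eq_sym k).
by rewrite mulrA -expr2 sqrCi mulN1r subrr mul0r.
Qed.

Lemma holo_cst V a : holo V (fun=> a).
Proof. by split=> [|i z _]; [exact: smooth_cst|exact: dzbar_cst]. Qed.

Lemma holo_coord V i : holo V (fun w => w 0 i).
Proof. by split=> [|k z _]; [exact: smooth_coord|exact: dzbar_coord]. Qed.

Lemma holo_sub V W f : V `<=` W -> holo W f -> holo V f.
Proof.
by move=> VW [sf df]; split=> [|i z /VW]; [exact: smooth_sub sf|exact: df].
Qed.

Lemma holoM V f g : open V -> holo V f -> holo V g -> holo V (fun w => f w * g w).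
Proof.
move=> oV [sf df] [sg dg]; split=> [|i z Vz]; first exact: smoothM.
by rewrite dzbarM ?df ?dg ?mul0r ?mulr0 ?addr0 //; exact: smooth_rdiff Vz.
Qed.

Lemma holo_sum V (I : Type) (s : seq I) (F : I -> vec -> C) : open V ->
  (forall k, holo V (F k)) -> holo V (fun w => \sum_(k <- s) F k w).
Proof.
move=> oV hF; split=> [|i z Vz]; first by apply: smooth_sum => // k; case: (hF k).
rewrite dzbar_sum => [|k]; last by case: (hF k) => sk _; exact: smooth_rdiff Vz.
by rewrite big1 // => k _; case: (hF k) => _; apply.
Qed.

End Smooth.

(** * Vector fields and connections in coordinates *)

Section Fields.
Context {R : realType} {m : nat}.
Local Notation C := (Cx R).
Local Notation vec := 'rV[C]_m.
Local Notation sec := (vec -> vec).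
Implicit Types (V W : set vec) (z v : vec) (X Y s : sec).
Implicit Types (L : vec -> vec -> vec) (G : vec -> vec -> vec -> vec).

Lemma row_bvec v : v = \sum_l v 0 l *: bvec l.
Proof. exact: row_sum_delta. Qed.

Lemma bvecE (a l : 'I_m) : bvec a 0 l = (a == l)%:R :> C.
Proof. by rewrite mxE eqxx eq_sym. Qed.

Lemma linear_sumZ (U W : lmodType C) (f : U -> W) (n : nat)
    (a : 'I_n -> C) (u : 'I_n -> U) :
  linear f -> f (\sum_k a k *: u k) = \sum_k a k *: f (u k).
Proof.
move=> lf.
pose F : {linear U -> W} :=
  HB.pack f (GRing.isLinear.Build C U W *:%R f lf).
have -> : f = F by [].
by rewrite linear_sum; apply: eq_bigr => k _; rewrite linearZ.
Qed.

Lemma linear_morph (U W : lmodType C) (f : U -> W) : linear f ->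
  [/\ f 0 = 0, {morph f : x y / x + y}, {morph f : x / - x} &
    forall a, {morph f : x / a *: x}].
Proof.
move=> lf.
pose F : {linear U -> W} :=
  HB.pack f (GRing.isLinear.Build C U W *:%R f lf).
have -> : f = F by [].
by split=> *; [exact: linear0|exact: linearD|exact: linearN|exact: linearZ].
Qed.

Lemma smooth_vec_cst V v : smooth_vec V (fun=> v).
Proof. by move=> k; exact: smooth_cst. Qed.

Lemma holo_vec_cst V v : holo_vec V (fun=> v).
Proof. by move=> k; exact: holo_cst. Qed.

Lemma smooth_vec_local V X Y : open V -> {in V, X =1 Y} ->
  smooth_vec V X -> smooth_vec V Y.
Proof.
by move=> oV XY sX k; apply: (smooth_local oV _ (sX k)) => w Vw; rewrite XY.
Qed.

Lemma dzv_cst i v z : dzv i (fun=> v) z = 0.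
Proof. by apply/rowP=> k; rewrite !mxE dz_cst. Qed.

Lemma dzbarv_cst i v z : dzbarv i (fun=> v) z = 0.
Proof. by apply/rowP=> k; rewrite !mxE dzbar_cst. Qed.

Lemma dzv_local V i X Y z : open V -> V z -> {in V, X =1 Y} ->
  dzv i X z = dzv i Y z.
Proof.
move=> oV Vz XY; apply/rowP=> k; rewrite !mxE.
by apply: dz_local oV Vz _ => w Vw; rewrite XY.
Qed.

Lemma derv_cst X v z : derv X (fun=> v) z = 0.
Proof. by rewrite /derv big1 // => i _; rewrite dzv_cst scaler0. Qed.

Lemma derv_bvec i Y z : derv (fun=> bvec i) Y z = dzv i Y z.
Proof.
rewrite /derv (bigD1 i) //= bvecE eqxx scale1r big1 ?addr0 // => l li.
by rewrite bvecE eq_sym (negPf li) scale0r.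
Qed.

Lemma derv_local V X Y Y' z : open V -> V z -> {in V, Y =1 Y'} ->
  derv X Y z = derv X Y' z.
Proof.
move=> oV Vz YY'; rewrite /derv; apply: eq_bigr => i _.
by rewrite (dzv_local i oV Vz YY').
Qed.

Lemma covd_cst G X v z : covd G X (fun=> v) z = G z (X z) v.
Proof. by rewrite /covd derv_cst add0r. Qed.

Lemma covd_local V G X Y Y' z : open V -> V z -> {in V, Y =1 Y'} ->
  covd G X Y z = covd G X Y' z.
Proof.
move=> oV Vz YY'; by rewrite /covd (derv_local _ oV Vz YY') YY'; last exact/mem_set.
Qed.

Lemma covd_sum G X Y z : linear (fun u => G z u (Y z)) ->
  covd G X Y z = \sum_i X z 0 i *: covd G (fun=> bvec i) Y z.
Proof.
move=> lG; transitivity (\sum_i X z 0 i *: dzv i Y z +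
              \sum_i X z 0 i *: G z (bvec i) (Y z)).
  by rewrite -(linear_sumZ _ _ lG) -row_bvec.
rewrite -big_split /=; apply: eq_bigr => i _.
by rewrite -scalerDr -derv_bvec.
Qed.

Lemma linear_field_coord V L s z k : (forall w, V w -> linear (L w)) ->
  V z -> L z (s z) 0 k = \sum_l s z 0 l * L z (bvec l) 0 k.
Proof.
move=> lL Vz; rewrite [in LHS](row_bvec (s z)) (linear_sumZ _ _ (lL z Vz)) summxE.
by apply: eq_bigr => l _; rewrite mxE.
Qed.

Lemma smooth_linear_field V L s : open V ->
  (forall w, V w -> linear (L w)) ->
  (forall l, smooth_vec V (fun w => L w (bvec l))) ->
  smooth_vec V s -> smooth_vec V (fun w => L w (s w)).
Proof.
move=> oV lL sL ss k.
apply: (@smooth_local _ _ _ (fun w => \sum_l s w 0 l * L w (bvec l) 0 k)) => //.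
  by move=> w /set_mem Vw; rewrite (linear_field_coord _ _ lL).
by apply: smooth_sum => // l; exact: smoothM oV (ss l) (sL l k).
Qed.

Lemma dzv_linear_field V L s i z : open V -> V z ->
  (forall w, V w -> linear (L w)) ->
  (forall l, smooth_vec V (fun w => L w (bvec l))) ->
  smooth_vec V s ->
  dzv i (fun w => L w (s w)) z =
    \sum_l s z 0 l *: dzv i (fun w => L w (bvec l)) z + L z (dzv i s z).
Proof.
move=> oV Vz lL sL ss; apply/rowP=> k.
have ds l : rdiff (fun w => s w 0 l) z by exact: smooth_rdiff (ss l) Vz.
have dL l : rdiff (fun w => L w (bvec l) 0 k) z by exact: smooth_rdiff (sL l k) Vz.
rewrite [LHS]mxE (@dz_local _ _ _ _ _
  (fun w => \sum_l s w 0 l * L w (bvec l) 0 k) _ oV Vz); last first.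
  by move=> w /set_mem Vw; rewrite (linear_field_coord _ _ lL).
rewrite dz_sum => [|l]; last exact: rdiffM.
rewrite [RHS]mxE (linear_field_coord (dzv i s) k lL Vz) summxE -big_split /=.
by apply: eq_bigr => l _; rewrite dzM // !mxE addrC.
Qed.

End Fields.

(** * Functions with zero derivatives on a polydisc *)

Section PolydiscConstant.
Context {R : realType} {m : nat}.
Local Notation C := (Cx R).
Local Notation vec := 'rV[C]_m.
Implicit Types (f : vec -> C) (z w v : vec).

Definition polydisc z0 (r : C) : set vec :=
  [set z | forall j, `|z0 0 j - z 0 j| < r].

Lemma open_polydisc z0 r : open (polydisc z0 r).
Proof.
rewrite openE => z z_in.
suff near_z : \forall w \near z, forall j, `|z0 0 j - (w : vec) 0 j| < r.
  exact: near_z.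
apply: (@filter_forall _ _ (fun j (w : vec) => `|z0 0 j - w 0 j| < r)
  (nbhs z) (nbhs_filter z)) => j.
have oB : open [set a : C | `|z0 0 j - a| < r].
  rewrite (_ : [set _ | _] = ball (z0 0 j) r); first exact: ball_open.
  by rewrite -ball_normE.
have nB : nbhs (z 0 j) [set a : C | `|z0 0 j - a| < r].
  by apply: open_nbhs_nbhs; split=> //; exact: z_in.
exact: (@coord_continuous C 1 m 0 j z _ nB).
Qed.

Lemma polydisc_sub (V : set vec) z0 : open V -> V z0 ->
  exists2 r : C, 0 < r & polydisc z0 r `<=` V.
Proof.
move=> oV Vz0; have /nbhs_ballP [r /= r0 rV] : nbhs z0 V by exact: open_nbhs_nbhs.
exists r => // z z_in; apply: rV; split=> // i j.
by rewrite (ord1 i) -ball_normE; exact: z_in.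
Qed.

Lemma is_derive0_const (h : R -> R) (a b : R) : a <= b ->
  (forall t : R, a <= t <= b -> is_derive t (1 : R) h 0) -> h a = h b.
Proof.
move=> ab dh.
have [||c _] := @MVT_segment R h (fun=> 0) a b ab.
- by move=> x /[!in_itv] /andP[ax xb]; apply: dh; rewrite !ltW.
- by apply: derivable_within_continuous => x /[!in_itv] /dh [].
by rewrite /= mul0r => /eqP; rewrite subr_eq0 => /eqP.
Qed.

Lemma line_const f v z (a b : R) : a <= b ->
  (forall t : R, a <= t <= b -> is_rder v f (z + real_complex R t *: v) 0) ->
  f (z + real_complex R a *: v) = f (z + real_complex R b *: v).
Proof.
move=> ab df.
(* is_rder differentiates at parameter 0 of the line through its base point,
   so the derivative at parameter t comes from the translated line. *)
have translate (h : vec -> R) t :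
    is_derive (0 : R) 1 (fun s : R =>
      h (z + real_complex R t *: v + real_complex R s *: v)) 0 ->
    is_derive t (1 : R) (fun s : R => h (z + real_complex R s *: v)) 0.
  move=> dh.
  have sub1 : is_derive t (1 : R) (fun s : R => s - t) 1.
    have := is_deriveB (is_derive_id t (1 : R)) (is_derive_cst t t (1 : R)).
    by move/is_derive_eq; apply; rewrite subr0.
  have dh' : is_derive (t - t) (1 : R) (fun s : R =>
      h (z + real_complex R t *: v + real_complex R s *: v)) 0.
    by rewrite subrr.
  have := @is_derive1_comp R _ (fun s => s - t) t _ _ dh' sub1.
  rewrite mul0r; congr is_derive; apply/funext => s /=.
  by rewrite -addrA -scalerDl -raddfD (addrC t) subrK.
have cRe := is_derive0_const ab (fun t abt =>
  translate (fun w => complex.Re (f w : complex R)) t (df t abt).1).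
have cIm := is_derive0_const ab (fun t abt =>
  translate (fun w => complex.Im (f w : complex R)) t (df t abt).2).
by apply/eqP; rewrite eq_complex; apply/andP; split; apply/eqP.
Qed.

(** Parametrizing the segment by [t * s] with [0 <= t <= 1] treats both signs of
    [s] uniformly. *)
Lemma line_const0 f v z (s : R) :
  (forall t : R, 0 <= t <= 1 -> is_rder v f (z + real_complex R (t * s) *: v) 0) ->
  f (z + real_complex R s *: v) = f z.
Proof.
move=> df; have z0 : z = z + real_complex R 0 *: v by rewrite raddf0 scale0r addr0.
have [->|s_neq0] := eqVneq s 0; first by rewrite -z0.
have df' t : 0 <= t / s <= 1 -> is_rder v f (z + real_complex R t *: v) 0.
  by move=> /df; rewrite divfK.
rewrite [in RHS]z0; have [s0|s0] := leP 0 s.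
  apply/esym/line_const => // t /andP[t0 ts]; apply: df'.
  have spos : 0 < s by rewrite lt_neqAle eq_sym s_neq0.
  by rewrite divr_ge0 //= ler_pdivrMr // mul1r.
apply: line_const; first exact: ltW.
move=> t /andP[st t0]; apply: df'.
rewrite -[t / s]mulrNN -invrN divr_ge0 ?oppr_ge0 ?(ltW s0) //=.
by rewrite ler_pdivrMr ?oppr_gt0 // mul1r lerN2.
Qed.

Lemma normc_le (x y x' y' : R) : `|x'| <= `|x| -> `|y'| <= `|y| ->
  `|Complex x' y' : C| <= `|Complex x y : C|.
Proof.
have sq_le (p q : R) : `|p| <= `|q| -> p ^+ 2 <= q ^+ 2.
  move=> pq; rewrite -(real_normK (num_real p)) -(real_normK (num_real q)).
  by rewrite ler_sqr ?nnegrE.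
move=> xx yy; rewrite ![`|_ : C|]normc_def lecR ler_wsqrtr //=.
by apply: lerD; exact: sq_le.
Qed.

Lemma dz_dzbar0 f z i : rdiff f z -> dz i f z = 0 -> dzbar i f z = 0 ->
  is_rder (bvec i) f z 0 /\ is_rder ('i *: bvec i) f z 0.
Proof.
move=> df; rewrite /dz /dzbar.
have two : (2 : C)^-1 != 0 by rewrite invr_eq0 pnatr_eq0.
move=> /eqP; rewrite mulf_eq0 (negPf two) orbF => /eqP d1.
move=> /eqP; rewrite mulf_eq0 (negPf two) orbF => /eqP d2.
have da : rderive (bvec i) f z = 0.
  have := congr2 +%R d1 d2; rewrite addr0 addrACA addNr addr0 -mulr2n => /eqP.
  by rewrite mulrn_eq0 => /eqP.
have db : rderive ('i *: bvec i) f z = 0.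
  move: d2; rewrite da add0r => /eqP; rewrite mulf_eq0 (negPf (neq0Ci _)).
  by move=> /eqP.
by split; [rewrite -da|rewrite -db]; exact: rdiff_is_rder.
Qed.

(** Any point of a polydisc is joined to its centre by segments parallel to the
    real and imaginary coordinate axes that stay in the polydisc, and [f] is
    constant along each of them. *)
Lemma polydisc_const f z0 r z :
  (forall w, polydisc z0 r w -> rdiff f w) ->
  (forall i w, polydisc z0 r w -> dz i f w = 0 /\ dzbar i f w = 0) ->
  polydisc z0 r z -> f z = f z0.
Proof.
move=> df f0 z_in.
have step w i : polydisc z0 r w ->
    f (w + (z0 0 i - w 0 i) *: bvec i) = f w.
  move=> w_in; case cE : (z0 0 i - w 0 i : complex R) => [x y].
  have ci : `|z0 0 i - w 0 i| = `|Complex x y : C| by rewrite -cE.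
  have in_disc a b : `|x - a| <= `|x| -> `|y - b| <= `|y| ->
      polydisc z0 r (w + (Complex a b : C) *: bvec i).
    move=> xa yb j; rewrite !mxE eqxx /=; have [->|ji] := eqVneq j i; last first.
      by rewrite mulr0 addr0; exact: w_in.
    rewrite mulr1 opprD addrA cE.
    apply: le_lt_trans (w_in i); rewrite ci.
    exact: (@normc_le _ _ (x - a) (y - b)).
  have norm_shrink (t s : R) : 0 <= t <= 1 -> `|s - t * s| <= `|s|.
    move=> /andP[t0 t1]; rewrite -{1}[s]mul1r -mulrBl normrM ger0_norm ?subr_ge0 //.
    by rewrite ler_piMl // gerBl.
  have ptE a b : w + (Complex a b : C) *: bvec i =
      w + real_complex R a *: bvec i + real_complex R b *: ('i *: bvec i).
    rewrite -addrA scalerA -scalerDl; congr (_ + _ *: _).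
    apply/eqP; rewrite eq_complex /=.
    by rewrite !(mulr0, mul0r, mulr1, addr0, add0r, subr0) !eqxx.
  have rder0 a b : `|x - a| <= `|x| -> `|y - b| <= `|y| ->
      is_rder (bvec i) f (w + (Complex a b : C) *: bvec i) 0 /\
      is_rder ('i *: bvec i) f (w + (Complex a b : C) *: bvec i) 0.
    move=> xa yb; have w'_in := in_disc a b xa yb.
    by have [] := f0 i _ w'_in; apply: dz_dzbar0; exact: df.
  rewrite ptE line_const0 => [|t t01]; last first.
    rewrite -ptE; apply: (rder0 _ _ _ _).2; rewrite ?subrr ?normr0 //.
    exact: norm_shrink.
  rewrite line_const0 // => t t01.
  rewrite -[_ + _ *: _]addr0 -(scale0r ('i *: bvec i)).
  rewrite -(rmorph0 (real_complex R)) -ptE.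
  by apply: (rder0 _ _ _ _).1; rewrite ?subr0 //; exact: norm_shrink.
suff agree (s : seq 'I_m) w : polydisc z0 r w ->
    (forall j, j \notin s -> w 0 j = z0 0 j) -> f w = f z0.
  by apply: (agree (enum 'I_m)) => // j; rewrite mem_enum.
elim: s w => [|i s IH] w w_in ws.
  by congr f; apply/rowP => j; exact: ws.
rewrite -(step w i w_in); apply: IH => j.
  rewrite !mxE eqxx /=; have [->|ji] := eqVneq j i; last first.
    by rewrite mulr0 addr0; exact: w_in.
  rewrite mulr1 addrC subrK subrr normr0.
  exact: le_lt_trans (normr_ge0 _) (w_in i).
move=> js; rewrite !mxE eqxx /=; have [->|ji] := eqVneq j i.
  by rewrite mulr1 addrC subrK.
by rewrite mulr0 addr0 ws // inE negb_or ji.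
Qed.

End PolydiscConstant.

(** * Restriction of charts *)

Section Restrict.
Context {R : realType} {m : nat} {T : topologicalType}.
Local Notation C := (Cx R).
Local Notation vec := 'rV[C]_m.
Variables (phi : lchart R m T) (B : set vec).
Hypothesis oB : open B.

Let rdom : set T := [set p | dom phi p /\ B (fwd phi p)].
Let rimg : set vec := img phi `&` B.

Lemma restrict_open_dom : open rdom.
Proof.
rewrite openE => p [dp Bp]; apply: filterI.
  by apply: open_nbhs_nbhs; split=> //; exact: open_dom.
apply: (fwd_cont (mem_set dp)).
by apply: open_nbhs_nbhs; split.
Qed.

Lemma restrict_open_img : open rimg.
Proof. by apply: openI => //; exact: open_img. Qed.

Lemma restrict_fwd_img p : rdom p -> rimg (fwd phi p).
Proof. by move=> [dp Bp]; split=> //; exact: fwd_img. Qed.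

Lemma restrict_bwd_dom z : rimg z -> rdom (bwd phi z).
Proof. by move=> [iz Bz]; split; [exact: bwd_dom|rewrite bwdK]. Qed.

Lemma restrict_fwdK p : rdom p -> bwd phi (fwd phi p) = p.
Proof. by move=> [dp _]; exact: fwdK. Qed.

Lemma restrict_bwdK z : rimg z -> fwd phi (bwd phi z) = z.
Proof. by move=> [iz _]; exact: bwdK. Qed.

Lemma restrict_fwd_cont : {in rdom, continuous (fwd phi)}.
Proof. by move=> p /set_mem[dp _]; exact: (fwd_cont (mem_set dp)). Qed.

Lemma restrict_bwd_cont : {in rimg, continuous (bwd phi)}.
Proof. by move=> z /set_mem[iz _]; exact: (bwd_cont (mem_set iz)). Qed.

Definition restrict_chart : lchart R m T :=
  LChart restrict_open_dom restrict_open_img restrict_fwd_img restrict_bwd_dom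
    restrict_fwdK restrict_bwdK restrict_fwd_cont restrict_bwd_cont.

End Restrict.

Section RestrictAtlas.
Context {R : realType} {m : nat} {M : complex_manifold R m}.
Local Notation C := (Cx R).
Local Notation vec := 'rV[C]_m.
Variables (phi : lchart R m M) (B : set vec).
Hypothesis oB : open B.
Local Notation psi := (restrict_chart phi oB).

Lemma atlas_restrict : atlas phi -> atlas psi.
Proof.
move=> aphi; apply: atlas_maximal => chi achi.
have [h1 h2] := atlas_compatible aphi achi.
split=> k; [apply: holo_sub (h1 k)|apply: holo_sub (h2 k)].
  by move=> z [[? _] ?]; split.
by move=> z [? [? _]]; split.
Qed.

Lemma canonical_restrict (mu : prod_type M) : is_holo_product mu ->
  canonical_coords mu phi -> canonical_coords mu psi.
Proof.
move=> muP [aphi can]; have apsi := atlas_restrict aphi.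
split=> // z a b [iz Bz].
have oz : overlap phi psi z.
  by split=> //; split; [exact: bwd_dom|rewrite bwdK].
have tz : trans phi psi z = z by rewrite /trans /= bwdK.
have oV : open (img phi) by exact: open_img.
have J1 : jac phi psi z = 1%:M.
  apply/matrixP => i k; rewrite !mxE.
  rewrite (@dz_local _ _ _ _ _ (fun w => w 0 k) _ oV iz) ?dz_coord //.
  by move=> w /set_mem iw; rewrite /trans /= bwdK.
have := product_trans muP (bvec a) (bvec b) aphi apsi oz.
by rewrite tz J1 !mulmx1 can // => ->.
Qed.

End RestrictAtlas.

(** * Diagonal cubic polynomials *)

Section CubicPotential.
Import -(notations) mpoly.
Context {R : realType} {m : nat}.
Local Notation C := (Cx R).
Local Notation vec := 'rV[C]_m.
Variable c : 'I_m -> C.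

Definition cubic (z : vec) : C := \sum_a c a * (z 0 a * z 0 a * z 0 a).

Lemma holo_cubic (V : set vec) : open V -> holo V cubic.
Proof.
move=> oV; apply: holo_sum => // a.
have ha := holo_coord V a.
exact: holoM oV (holo_cst V (c a)) (holoM oV (holoM oV ha ha) ha).
Qed.

Lemma dz_cubic k : dz k cubic = fun z => 3 * c k * (z 0 k * z 0 k).
Proof.
apply/funext => z.
have d1 a : rdiff (fun w : vec => w 0 a) z by exact: rdiff_coord.
have d3 a : rdiff (fun w : vec => w 0 a * w 0 a * w 0 a) z.
  by apply: rdiffM => //; apply: rdiffM.
rewrite dz_sum => [|a]; last by apply: rdiffM => //; exact: rdiff_cst.
rewrite (bigD1 k) //= big1 ?addr0 => [|a ak].
  rewrite dzM ?dz_cst // ?mul0r ?add0r; last exact: rdiff_cst.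
  rewrite dzM ?dzM ?dz_coord ?eqxx //; last exact: rdiffM.
  move: (z 0 k) (c k) => x ck.
  by rewrite !(mul1r, mulr1); ring.
rewrite dzM // ?dz_cst ?mul0r ?add0r; last exact: rdiff_cst.
rewrite dzM ?dzM ?dz_coord //; last exact: rdiffM.
by rewrite eq_sym (negPf ak) !(mul0r, mulr0, addr0).
Qed.

Lemma dz2_cubic j k :
  dz j (dz k cubic) = fun z => 6 * c k * (j == k)%:R * z 0 k.
Proof.
apply/funext => z; rewrite dz_cubic.
have d1 a : rdiff (fun w : vec => w 0 a) z by exact: rdiff_coord.
rewrite dzM; [|exact: rdiff_cst|exact: rdiffM].
rewrite dz_cst mul0r add0r dzM // dz_coord.
by move: (j == k)%:R (z 0 k) (c k) => x y ck; ring.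
Qed.

Lemma dz3_cubic i j k z :
  dz i (dz j (dz k cubic)) z = 6 * c k * (j == k)%:R * (i == k)%:R.
Proof.
rewrite dz2_cubic dzM; [|exact: rdiff_cst|exact: rdiff_coord].
by rewrite dz_cst mul0r add0r dz_coord.
Qed.

Definition cubic_mpoly : mpoly.mpoly m C :=
  \sum_a c a *: mpoly.mpolyX C (mpoly.mnm_muln (mpoly.mnm1 a) 3).

Lemma meval_cubic_mpoly (z : vec) :
  mpoly.meval (fun i => z 0 i) cubic_mpoly = cubic z.
Proof.
rewrite /cubic_mpoly (big_morph _ (mpoly.mevalD _) (mpoly.meval0 _)).
apply: eq_bigr => a _; rewrite mpoly.mevalZ mpoly.mevalX; congr (_ * _).
rewrite (bigD1 a) //= mpoly.mulmnE mpoly.mnm1E eqxx big1 => [|b ba].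
  by rewrite mulr1 mul1n !exprS expr0 mulr1 mulrA.
by rewrite mpoly.mulmnE mpoly.mnm1E eq_sym (negPf ba) expr0.
Qed.

Lemma mcoeff_cubic_mpoly k : mpoly.mcoeff k cubic_mpoly =
  \sum_a c a * (mpoly.mnm_muln (mpoly.mnm1 a) 3 == k)%:R.
Proof.
rewrite /cubic_mpoly (big_morph _ (mpoly.mcoeffD _) (mpoly.mcoeff0 _ _)).
by apply: eq_bigr => a _; rewrite mpoly.mcoeffZ mpoly.mcoeffX.
Qed.

Lemma mdeg_cubic_mpoly : (0 < m)%N -> (forall a, c a != 0) ->
  (\max_(k <- mpoly.msupp cubic_mpoly) mpoly.mdeg k)%N = 3%N.
Proof.
move=> m_gt0 c_neq0.
have mdeg3 a :
    mpoly.mdeg (mpoly.mnm_muln (mpoly.mnm1 a : mpoly.multinom m) 3) = 3%N.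
  by rewrite mpoly.mdegMn mpoly.mdeg1.
apply/eqP; rewrite eqn_leq; apply/andP; split.
  apply/bigmax_leqP_seq => k; rewrite mpoly.mcoeff_msupp mcoeff_cubic_mpoly.
  move=> k_supp _.
  have [[a /eqP <-]|no] :=
      pselect (exists a, mpoly.mnm_muln (mpoly.mnm1 a) 3 == k).
    by rewrite mdeg3.
  case/negP: k_supp; rewrite big1 // => a _.
  case: eqP => [ak|]; last by rewrite mulr0.
  by case: no; exists a; apply/eqP.
pose a0 := Ordinal m_gt0.
rewrite -[X in (X <= _)%N](mdeg3 a0).
apply: (@leq_bigmax_seq _ _ _ _ (mpoly.mnm_muln (mpoly.mnm1 a0) 3)) => //.
rewrite mpoly.mcoeff_msupp mcoeff_cubic_mpoly (bigD1 a0) //= eqxx mulr1.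
rewrite big1 ?addr0 // => a aa0; case: eqP => [|_]; last by rewrite mulr0.
move=> /(congr1 (fun k : mpoly.multinom m => mpoly.fun_of_multinom k a)).
by rewrite !mpoly.mulmnE !mpoly.mnm1E eqxx eq_sym (negPf aa0).
Qed.

End CubicPotential.

(** * Comparison of the two connections *)

Section FrobeniusCDV.
Context {R : realType} {m : nat} {M : complex_manifold R m}.
Local Notation C := (Cx R).
Local Notation vec := 'rV[C]_m.
Local Notation sec := (vec -> vec).
Context (g : form_type M) (mu : prod_type M) (e E : vfield_type M) (d : C)
    (nabla : prod_type M) (kappa : bundle_map_type M) (D' : prod_type M).
Hypothesis frobM : is_frobenius g mu e E d nabla.
Hypothesis cdvM : is_CDV g mu e E d kappa D'.

Let nabla_conn : is_connection10 nabla := (frob_levi_civita frobM).1.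
Let D'_conn : is_connection10 D' := (cdv_chern cdvM).1.

(** On constant sections a connection is given by its coefficients. *)
Lemma same_connectionP : same_connection D' nabla <->
  forall phi z u v, atlas phi -> img phi z -> D' phi z u v = nabla phi z u v.
Proof.
split=> [same phi z u v aphi Vz|same phi aphi X sX s ss z Vz].
  have := same phi aphi _ (smooth_vec_cst _ u) _ (smooth_vec_cst _ v) z Vz.
  by rewrite !covd_cst.
by rewrite /covd same.
Qed.

Section Kappa.
Variables (phi : lchart R m M) (z : vec).
Hypotheses (aphi : atlas phi) (Vz : img phi z).

Lemma kappaD v w : kappa phi z (v + w) = kappa phi z v + kappa phi z w.
Proof.
by rewrite -{1}[v]scale1r (kappa_antilinear (cdv_kappa cdvM)) // conjC1 scale1r.
Qed.

Lemma kappa0 : kappa phi z 0 = 0.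
Proof. by apply: (addrI (kappa phi z 0)); rewrite -kappaD !addr0. Qed.

Lemma kappaZ a v : kappa phi z (a *: v) = a^* *: kappa phi z v.
Proof.
by rewrite -[a *: v]addr0 (kappa_antilinear (cdv_kappa cdvM)) // kappa0 addr0.
Qed.

Lemma kappaN v : kappa phi z (- v) = - kappa phi z v.
Proof. by rewrite -scaleN1r kappaZ rmorphN1 scaleN1r. Qed.

Lemma kappa_sum (I : Type) (s : seq I) (F : I -> vec) :
  kappa phi z (\sum_(i <- s) F i) = \sum_(i <- s) kappa phi z (F i).
Proof. exact: (big_morph _ kappaD kappa0). Qed.

Lemma kappaK v : kappa phi z (kappa phi z v) = v.
Proof. exact: (kappa_invol (cdv_kappa cdvM)). Qed.

End Kappa.

(** Both [nabla] and [D'] are compared with [dbar] through [kappa]; testing on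
    constant sections [kappa v], whose [dbar] vanishes, gives equal coefficients. *)
Lemma kappa_flatP : kappa_flat nabla kappa <-> same_connection D' nabla.
Proof.
split=> [flat|/same_connectionP eqD].
  apply/same_connectionP => phi z u v aphi Vz.
  have lD w := connection_linearl D'_conn w aphi Vz.
  have lN w := connection_linearl nabla_conn w aphi Vz.
  rewrite (row_bvec u) (linear_sumZ _ _ (lD v)) (linear_sumZ _ _ (lN v)).
  apply: eq_bigr => i _; congr (_ *: _).
  have [+ _] := cv_D_kappa (cdv_CV cdvM aphi) i.
  move=> /(_ _ (smooth_vec_cst _ (kappa phi z v)) z Vz).
  have [+ _] := flat phi aphi _ (smooth_vec_cst _ (bvec i)).
  move=> /(_ _ (smooth_vec_cst _ (kappa phi z v)) z Vz).
  rewrite /fiberwise /= /dbar_conj dzbarv_cst.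
  rewrite big1 => [|l _]; last by rewrite dzbarv_cst scaler0.
  by move=> <-; rewrite /covd kappaK // => /addrI.
move=> phi aphi X sX; split=> s ss z Vz; rewrite /=.
  rewrite covd_sum; last exact: connection_linearl.
  rewrite /fiberwise /dbar_conj kappa_sum //; apply: eq_bigr => i _.
  rewrite kappaZ // conjCK; congr (_ *: _).
  have [/(_ s ss z Vz) + _] := cv_D_kappa (cdv_CV cdvM aphi) i.
  by rewrite /fiberwise /= => <-; rewrite /covd eqD.
rewrite /fiberwise covd_sum; last exact: connection_linearl.
rewrite kappa_sum //; apply: eq_bigr => i _; rewrite kappaZ //; congr (_ *: _).
have [_ /(_ s ss z Vz)] := cv_D_kappa (cdv_CV cdvM aphi) i.
by rewrite /fiberwise /= => ->; rewrite /covd eqD.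
Qed.

(** * The algebras of tangent vectors *)

Section Point.
Variables (phi : lchart R m M) (z : vec).
Hypotheses (aphi : atlas phi) (Vz : img phi z).
Let mul := mu phi z.

Let muL v : linear (mul v).
Proof. exact: (product_linear (frob_product frobM)). Qed.

Lemma muC v w : mul v w = mul w v.
Proof. exact: (product_comm (frob_product frobM)). Qed.

Lemma muA u v w : mul u (mul v w) = mul (mul u v) w.
Proof. exact: (product_assoc (frob_product frobM)). Qed.

Lemma mu1l v : mul (e phi z) v = v.
Proof. exact: (frob_unit frobM). Qed.

Lemma mu1r v : mul v (e phi z) = v.
Proof. by rewrite muC mu1l. Qed.

Lemma mu0r v : mul v 0 = 0.
Proof. by have [-> _ _ _] := linear_morph (muL v). Qed.

Lemma muDr v : {morph mul v : x y / x + y}.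
Proof. by have [_ + _ _] := linear_morph (muL v). Qed.

Lemma muNr v : {morph mul v : x / - x}.
Proof. by have [_ _ + _] := linear_morph (muL v). Qed.

Lemma muZr v a : {morph mul v : x / a *: x}.
Proof. by have [_ _ _] := linear_morph (muL v). Qed.

Lemma muDl v : {morph mul^~ v : x y / x + y}.
Proof. by move=> x y /=; rewrite muC muDr !(muC v). Qed.

Lemma muNl v : {morph mul^~ v : x / - x}.
Proof. by move=> x /=; rewrite muC muNr (muC v). Qed.

Lemma mu_sumr v a (u : 'I_m -> vec) :
  mul v (\sum_k a k *: u k) = \sum_k a k *: mul v (u k).
Proof. exact: linear_sumZ (muL v). Qed.

Lemma mu_suml v a (u : 'I_m -> vec) :
  mul (\sum_k a k *: u k) v = \sum_k a k *: mul (u k) v.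
Proof. by rewrite muC mu_sumr; apply: eq_bigr => k _; rewrite muC. Qed.

End Point.

Lemma mu_linear phi z v : atlas phi -> img phi z -> linear (mu phi z v).
Proof. by move=> aphi Vz; exact: (product_linear (frob_product frobM)). Qed.

Lemma mu_smooth phi x (s : sec) : atlas phi -> smooth_vec (img phi) s ->
  smooth_vec (img phi) (fun w => mu phi w x (s w)).
Proof.
move=> aphi; have oV : open (img phi) by exact: open_img.
move=> ss.
apply: (@smooth_linear_field _ _ _ (fun w => mu phi w x) s oV) => // [w Vw|l].
  exact: mu_linear.
apply: (@smooth_vec_local _ _ _ (fun w => mu phi w (bvec l) x)) => //.
  by move=> w /set_mem Vw; exact: muC.
apply: (@smooth_linear_field _ _ _ (fun w => mu phi w (bvec l)) (fun=> x) oV)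
  => [w Vw|k|].
- exact: mu_linear.
- by move=> i; case: (product_holo (frob_product frobM) l k aphi i).
- exact: smooth_vec_cst.
Qed.

Lemma metric0r phi z v : atlas phi -> img phi z -> g phi z v 0 = 0.
Proof.
move=> aphi Vz; have lg := metric_linear (frob_metric frobM) v aphi Vz.
by have := lg (-1) 0 0; rewrite scaler0 addr0 mulN1r addNr.
Qed.

Lemma metricZr phi z v a w : atlas phi -> img phi z ->
  g phi z v (a *: w) = a * g phi z v w.
Proof.
move=> aphi Vz; have lg := metric_linear (frob_metric frobM) v aphi Vz.
by rewrite -[a *: w]addr0 lg metric0r // addr0.
Qed.

Lemma metric0l phi z v : atlas phi -> img phi z -> g phi z 0 v = 0.
Proof.
by move=> aphi Vz; rewrite (Defs.metric_sym (frob_metric frobM)) // metric0r.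
Qed.

(** For an idempotent [p], [delta p = 2 p o delta p]; multiplying by [p] gives
    [p o delta p = 0], hence [delta p = 0].  The coordinate fields of a canonical
    chart, carried to the given chart by the Jacobian, are idempotents; they span
    because the Jacobian preserves the nondegenerate metric, hence is injective. *)
Lemma derivation0 phi z (delta : vec -> vec) v :
  semisimple mu -> atlas phi -> img phi z -> linear delta ->
  (forall x y, delta (mu phi z x y) =
     mu phi z (delta x) y + mu phi z x (delta y)) ->
  delta v = 0.
Proof.
move=> ss aphi Vz ldelta der.
have [psi [apsi can] dpsi] := ss (bwd phi z).
pose z' := fwd psi (bwd phi z); pose J := jac psi phi z'.
have Vz' : img psi z' by exact: fwd_img.
have tz : trans psi phi z' = z by rewrite /trans /= fwdK // bwdK.
have oz : overlap psi phi z' by split; rewrite // fwdK //; exact: bwd_dom.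
have Ju : J \in unitmx.
  rewrite -row_free_unit; apply: inj_row_free => u uJ.
  apply: (metric_nondeg (frob_metric frobM) apsi Vz') => w.
  rewrite -(metric_trans (frob_metric frobM) _ _ apsi aphi oz) -/J uJ metric0l //.
  by rewrite tz.
have idem a : mu phi z (bvec a *m J) (bvec a *m J) = bvec a *m J.
  by rewrite -{1}tz (product_trans (frob_product frobM)) // can // eqxx mulr1n.
have delta_idem p : mu phi z p p = p -> delta p = 0.
  move=> pp; have pE : delta p = mu phi z p (delta p) + mu phi z p (delta p).
    by rewrite -{1}pp der (muC aphi Vz).
  have pdp : mu phi z p (delta p) = 0.
    move: (congr1 (mu phi z p) pE).
    rewrite (muDr aphi Vz) (muA aphi Vz) pp => /eqP.
    by rewrite -subr_eq0 opprD addrA subrr sub0r oppr_eq0 => /eqP.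
  by rewrite pE pdp addr0.
have -> : v = \sum_a (v *m invmx J) 0 a *: (bvec a *m J).
  rewrite -[v in LHS](mulmxKV Ju) [v *m _ in LHS]row_bvec mulmx_suml.
  by apply: eq_bigr => a _; rewrite scalemxAl.
rewrite (linear_sumZ _ _ ldelta) big1 // => a _.
by rewrite delta_idem // scaler0.
Qed.

Lemma bvec_neq0 a : bvec a != 0 :> vec.
Proof.
apply/eqP => /(congr1 (fun v : vec => v 0 a)) /eqP.
by rewrite bvecE eqxx mxE oner_eq0.
Qed.

Section Canonical.
Variable phi : lchart R m M.
Hypothesis can : canonical_coords mu phi.
Let aphi : atlas phi := can.1.

Lemma canonical_muE z x y : img phi z ->
  mu phi z x y = \sum_a x 0 a *: (y 0 a *: bvec a).
Proof.
move=> Vz; rewrite [in LHS](row_bvec x) (mu_suml aphi Vz).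
apply: eq_bigr => a _; congr (_ *: _).
rewrite [in LHS](row_bvec y) (mu_sumr aphi Vz) (bigD1 a) //=.
rewrite can.2 // eqxx mulr1n big1 ?addr0 // => b ba.
by rewrite can.2 // eq_sym (negPf ba) mulr0n scaler0.
Qed.

Lemma canonical_mul z a y : img phi z -> mu phi z (bvec a) y = y 0 a *: bvec a.
Proof.
move=> Vz; rewrite canonical_muE // (bigD1 a) //= bvecE eqxx scale1r.
rewrite big1 ?addr0 // => b ba.
by rewrite bvecE eq_sym (negPf ba) scale0r.
Qed.

(** [g(a, b) = g(a o a, b) = g(a, a o b) = 0]. *)
Lemma canonical_orth z a b : img phi z -> a != b -> g phi z (bvec a) (bvec b) = 0.
Proof.
move=> Vz ab; have {1}<- : mu phi z (bvec a) (bvec a) = bvec a.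
  by rewrite can.2 // eqxx.
rewrite (frob_invariant frobM) // can.2 // (negPf ab) mulr0n.
exact: metric0r.
Qed.

Lemma canonical_eta_neq0 z a : img phi z -> eta_of g phi z a != 0.
Proof.
move=> Vz; apply/eqP => eta0; have /eqP := bvec_neq0 a; apply.
apply: (metric_nondeg (frob_metric frobM) aphi Vz) => w.
have lg := metric_linear (frob_metric frobM) (bvec a) aphi Vz.
rewrite (row_bvec w) (linear_sumZ (W := C^o) _ _ lg).
rewrite big1 // => b _; have [<-|ab] := eqVneq a b; last first.
  by rewrite canonical_orth // scaler0.
by rewrite -/(eta_of g phi z a) eta0 scaler0.
Qed.

End Canonical.

(** * Parallelism of the product *)

Hypothesis eqD : forall phi z u v, atlas phi -> img phi z ->
  D' phi z u v = nabla phi z u v.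

Section Parallel.
Variable phi : lchart R m M.
Hypothesis aphi : atlas phi.

Let oV : open (img phi). Proof. exact: open_img. Qed.

Let G_linearr z u (Vz : img phi z) : linear (nabla phi z u) :=
  connection_linearr (frob_levi_civita frobM).1 u aphi Vz.
Let G_linearl z v (Vz : img phi z) : linear (fun u => nabla phi z u v) :=
  connection_linearl (frob_levi_civita frobM).1 v aphi Vz.

(** The component of [kappa C kappa] along d/d(conj z^k). *)
Definition adjoint_higgs k z v :=
  kappa phi z (- mu phi z (bvec k) (kappa phi z v)).
Local Notation Ct := adjoint_higgs.

Lemma smooth_adjoint_higgs k s : smooth_vec (img phi) s ->
  smooth_vec (img phi) (fun w => Ct k w (s w)).
Proof.
have ksm t : smooth_vec (img phi) t ->
    smooth_vec (img phi) (fun w => kappa phi w (t w)).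
  move=> st i; apply: (@smooth_local _ _ _
    (fun w => \sum_l (t w 0 l)^* * kappa phi w (bvec l) 0 i)) => //.
    move=> w /set_mem Vw; rewrite [in RHS](row_bvec (t w)) kappa_sum //.
    by rewrite summxE; apply: eq_bigr => l _; rewrite kappaZ // mxE.
  apply: smooth_sum => // l; apply: smoothM => //.
    exact: smooth_conj oV (st l).
  exact: (kappa_smooth (cdv_kappa cdvM) l aphi).
move=> ss; apply: (ksm) => i.
have := smoothM oV (smooth_cst _ (-1)) (mu_smooth (bvec k) aphi (ksm _ ss) i).
by apply: smooth_local => // w _; rewrite mxE mulN1r.
Qed.

Lemma linear_adjoint_higgs k z : img phi z -> linear (Ct k z).
Proof.
move=> Vz a v w; rewrite /Ct kappaD // kappaZ //.
rewrite (muDr aphi Vz) (muZr aphi Vz) opprD -scalerN.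
by rewrite kappaD // kappaZ // conjCK.
Qed.

Lemma nabla_same i s z : img phi z ->
  covd (D' phi) (fun=> bvec i) s z = covd (nabla phi) (fun=> bvec i) s z.
Proof. by move=> Vz; rewrite /covd eqD. Qed.

(** Evaluated on a constant section, the left side of the curvature equation is
    [- dbar_k (nabla_j v)], which vanishes because [nabla] is holomorphic. *)
Lemma mu_adjoint_higgs z x k v : img phi z ->
  mu phi z x (Ct k z v) = Ct k z (mu phi z x v).
Proof.
move=> Vz.
suff comm_bvec j : mu phi z (bvec j) (Ct k z v) = Ct k z (mu phi z (bvec j) v).
  rewrite (row_bvec x) !(mu_suml aphi Vz).
  rewrite (linear_sumZ _ _ (linear_adjoint_higgs k Vz)).
  by apply: eq_bigr => j _; rewrite comm_bvec.
(* the (d/dz^j, d/d(conj z^k)) component; the zeros are the components of the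
   forms in the absent directions *)
have curv : (covd (D' phi) (fun=> bvec j) (dzbarv k (fun=> v)) z - 0) +
    (0 - dzbarv k (covd (D' phi) (fun=> bvec j) (fun=> v)) z) =
    - ((- mu phi z (bvec j) (Ct k z v) - 0) +
       (0 - Ct k z (- mu phi z (bvec j) v))).
  exact: cv_curvature (cdv_CV cdvM aphi) (inl j) (inr k) _
    (smooth_vec_cst _ v) z Vz.
move: curv; rewrite !subr0 !sub0r.
have -> : dzbarv k (fun=> v) = fun=> 0 :> vec.
  by apply/funext => w; rewrite dzbarv_cst.
have lD := connection_linearr D'_conn (bvec j) aphi Vz.
rewrite covd_cst; have [-> _ _ _] := linear_morph lD.
have -> : dzbarv k (covd (D' phi) (fun=> bvec j) (fun=> v)) z = 0.
  apply/rowP => l; rewrite !mxE.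
  pose Gl i w := nabla phi w (bvec j) (bvec i) 0 l.
  have hG i : holo (img phi) (Gl i).
    by case: (frob_levi_civita frobM) => _ /(_ phi aphi) [+ _]; apply.
  rewrite (@dzbar_local _ _ _ _ _ (fun w => \sum_i v 0 i * Gl i w) _ oV Vz);
    last first.
    move=> w /set_mem Vw; rewrite nabla_same // covd_cst [in LHS](row_bvec v).
    rewrite (linear_sumZ _ _ (G_linearr _ Vw)) summxE.
    by apply: eq_bigr => i _; rewrite mxE.
  have hs : holo (img phi) (fun w => \sum_i v 0 i * Gl i w).
    by apply: holo_sum => // i; apply: holoM => //; exact: holo_cst.
  by case: hs => _; apply.
rewrite oppr0 addr0 opprD opprK opprK.
have [_ _ -> _] := linear_morph (linear_adjoint_higgs k Vz).
by move/esym/eqP; rewrite subr_eq0 => /eqP.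
Qed.

(** This is the mixed component of [(C~ + D')^2 = 0]. *)
Lemma nabla_adjoint_higgs i k s z : img phi z -> smooth_vec (img phi) s ->
  covd (nabla phi) (fun=> bvec i) (fun w => Ct k w (s w)) z =
  Ct k z (covd (nabla phi) (fun=> bvec i) s z).
Proof.
move=> Vz ss; rewrite -!nabla_same //.
have := cv_Ct_D1_sq (cdv_CV cdvM aphi) (inl i) (inr k) ss Vz.
rewrite /wedge (_ : (_ + _) (inl i) = covd (D' phi) (fun=> bvec i)); last first.
  exact: add0r.
rewrite (_ : (_ + _) (inr k) = fun s w => Ct k w (s w)); last exact: addr0.
by move/eqP; rewrite subr_eq0 => /eqP.
Qed.

(** The commutator [[nabla_i, x o]] for constant [x], which acts pointwise by
    [dmu_tensor]. *)
Definition dmu z i x y :=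
  covd (nabla phi) (fun=> bvec i) (fun w => mu phi w x y) z
    - mu phi z x (nabla phi z (bvec i) y).

Lemma dmu_tensor z i x s : img phi z -> smooth_vec (img phi) s ->
  covd (nabla phi) (fun=> bvec i) (fun w => mu phi w x (s w)) z
    - mu phi z x (covd (nabla phi) (fun=> bvec i) s z) = dmu z i x (s z).
Proof.
move=> Vz ss; rewrite /dmu /covd !derv_bvec.
have lmu w : img phi w -> linear (mu phi w x) by exact: (mu_linear x aphi).
have smu l : smooth_vec (img phi) (fun w => mu phi w x (bvec l)).
  exact: (mu_smooth x aphi (smooth_vec_cst _ _)).
rewrite (dzv_linear_field i oV Vz lmu smu ss).
rewrite (dzv_linear_field i oV Vz lmu smu (smooth_vec_cst _ (s z))).
rewrite dzv_cst (mu0r aphi Vz) addr0 (muDr aphi Vz) opprD.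
by rewrite [in LHS]addrAC addrA addrK addrAC.
Qed.

Lemma dmu_linear z i x : img phi z -> linear (dmu z i x).
Proof.
move=> Vz a v w; rewrite /dmu /covd !derv_bvec.
have lmu w' : img phi w' -> linear (mu phi w' x) by exact: (mu_linear x aphi).
have smu l : smooth_vec (img phi) (fun w => mu phi w x (bvec l)).
  exact: (mu_smooth x aphi (smooth_vec_cst _ _)).
rewrite !(dzv_linear_field i oV Vz lmu smu (smooth_vec_cst _ _)).
rewrite !dzv_cst (mu0r aphi Vz) !addr0 G_linearr //.
rewrite !(muDr aphi Vz) !(muZr aphi Vz) G_linearr //.
have -> : \sum_l (a *: v + w) 0 l *: dzv i (fun w => mu phi w x (bvec l)) z =
    a *: (\sum_l v 0 l *: dzv i (fun w => mu phi w x (bvec l)) z) +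
    \sum_l w 0 l *: dzv i (fun w => mu phi w x (bvec l)) z.
  rewrite scaler_sumr -big_split; apply: eq_bigr => l _ /=.
  by rewrite !mxE scalerDl scalerA.
by rewrite scalerBr scalerDr opprD (addrACA (a *: _) _ (a *: _)) [LHS]addrACA.
Qed.

(** Jacobi identity: both [nabla_i] and [x o] commute with [C~_k], hence so does
    their commutator. *)
Lemma dmu_adjoint_higgs z i x k y : img phi z ->
  dmu z i x (Ct k z y) = Ct k z (dmu z i x y).
Proof.
move=> Vz; have sy := smooth_vec_cst (img phi) y.
rewrite -(dmu_tensor i x Vz (smooth_adjoint_higgs k sy)).
rewrite nabla_adjoint_higgs // mu_adjoint_higgs //.
rewrite (@covd_local _ _ _ _ _ _ (fun w => Ct k w (mu phi w x y)) _ oV Vz);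
  last first.
  by move=> w /set_mem Vw; exact: mu_adjoint_higgs.
rewrite nabla_adjoint_higgs //; last exact: (mu_smooth x aphi).
rewrite -(dmu_tensor i x Vz sy).
have [_ ctD ctN _] := linear_morph (linear_adjoint_higgs k Vz).
by rewrite -ctN -ctD.
Qed.

Lemma kappa_mu_kappa z u v : img phi z ->
  kappa phi z (mu phi z u (kappa phi z v)) =
  \sum_k (u 0 k)^* *: - Ct k z v.
Proof.
move=> Vz; rewrite [in LHS](row_bvec u) (mu_suml aphi Vz) kappa_sum //.
by apply: eq_bigr => k _; rewrite kappaZ // /Ct kappaN // opprK.
Qed.

(** [kappa (u o) kappa] is a combination of the components of [C~]. *)
Lemma mu_kappa_mu_kappa z x u v : img phi z ->
  mu phi z x (kappa phi z (mu phi z u (kappa phi z v))) =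
  kappa phi z (mu phi z u (kappa phi z (mu phi z x v))).
Proof.
move=> Vz; rewrite !kappa_mu_kappa // (mu_sumr aphi Vz).
by apply: eq_bigr => k _; rewrite (muNr aphi Vz) mu_adjoint_higgs.
Qed.

Lemma dmu_kappa_mu_kappa z i x u v : img phi z ->
  dmu z i x (kappa phi z (mu phi z u (kappa phi z v))) =
  kappa phi z (mu phi z u (kappa phi z (dmu z i x v))).
Proof.
move=> Vz; rewrite !kappa_mu_kappa // (linear_sumZ _ _ (dmu_linear i x Vz)).
have [_ _ dN _] := linear_morph (dmu_linear i x Vz).
by apply: eq_bigr => k _; rewrite dN dmu_adjoint_higgs.
Qed.

(** Put [f x = kappa (x o kappa e)].  As [kappa (x o) kappa] commutes with
    multiplications, it is multiplication by its value [f x] at the unit.  Applied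
    to [kappa e] this reads [f x o kappa e = kappa x], that is [f (f x) = x]. *)
Lemma mu_is_kappa_mu_kappa z y : img phi z ->
  exists u, forall v, mu phi z y v = kappa phi z (mu phi z u (kappa phi z v)).
Proof.
move=> Vz; pose f x := kappa phi z (mu phi z x (kappa phi z (e phi z))).
have fE x v : kappa phi z (mu phi z x (kappa phi z v)) = mu phi z (f x) v.
  by rewrite -[in LHS](mu1r aphi Vz v) -mu_kappa_mu_kappa // (muC aphi Vz).
have ff x : f (f x) = x.
  transitivity (kappa phi z (mu phi z (f x) (kappa phi z (e phi z)))) => //.
  rewrite -fE kappaK // kappaK //.
  by rewrite (mu1r aphi Vz).
by exists (f y) => v; rewrite fE ff.
Qed.

Lemma dmu_mu z i x y v : img phi z ->
  dmu z i x (mu phi z y v) = mu phi z y (dmu z i x v).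
Proof.
move=> Vz; have [u yE] := mu_is_kappa_mu_kappa y Vz.
by rewrite !yE dmu_kappa_mu_kappa.
Qed.

(** The unit field is flat and [x o e = x], so only [nabla_i x] remains. *)
Lemma dmu_unit z i x : img phi z -> dmu z i x (e phi z) = nabla phi z (bvec i) x.
Proof.
move=> Vz.
have se : smooth_vec (img phi) (e phi).
  by move=> k; case: (frob_unit_holo frobM) => /(_ phi aphi k) [].
rewrite -(dmu_tensor i x Vz se).
rewrite (frob_unit_flat frobM aphi (holo_vec_cst _ _) Vz) (mu0r aphi Vz) subr0.
rewrite (@covd_local _ _ _ _ _ _ (fun=> x) _ oV Vz) ?covd_cst //.
by move=> w /set_mem Vw; exact: mu1r.
Qed.

(** [[nabla_i, x o]] commutes with multiplications, so its value at [y = y o e] is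
    [y o nabla_i x] by [dmu_unit]. *)
Lemma product_parallel z (X : sec) x y : img phi z ->
  covd (nabla phi) X (fun w => mu phi w x y) z =
  mu phi z (nabla phi z (X z) x) y + mu phi z x (nabla phi z (X z) y).
Proof.
move=> Vz; rewrite covd_sum; last exact: G_linearl.
rewrite [in RHS](row_bvec (X z)) !(linear_sumZ _ _ (G_linearl _ Vz)).
rewrite (mu_suml aphi Vz) (mu_sumr aphi Vz) -big_split /=.
apply: eq_bigr => i _; rewrite -scalerDr; congr (_ *: _).
apply/eqP; rewrite -subr_eq; apply/eqP; rewrite -[LHS]/(dmu z i x y).
rewrite -[in LHS](mu1r aphi Vz y) dmu_mu // dmu_unit //.
exact: muC.
Qed.

End Parallel.

(** * Semi-simple Frobenius manifolds *)

Hypothesis ss : semisimple mu.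

(** In canonical coordinates [x o y] is a constant field for constant [x], [y], so
    the parallel product says that [nabla_u] is a derivation of the algebra. *)
Lemma canonical_nabla0 phi z u v : canonical_coords mu phi -> img phi z ->
  nabla phi z u v = 0.
Proof.
move=> can Vz; have aphi := can.1.
have oV : open (img phi) by exact: open_img.
apply: (@derivation0 phi z (nabla phi z u)) => // [|x y].
  exact: (connection_linearr (frob_levi_civita frobM).1).
rewrite -(product_parallel aphi (fun=> u) x y Vz).
rewrite (@covd_local _ _ _ _ _ _ (fun=> mu phi z x y) _ oV Vz) ?covd_cst //.
by move=> w /set_mem Vw; rewrite !canonical_muE.
Qed.

Lemma canonical_flat phi : canonical_coords mu phi -> flat_coordinates nabla phi.
Proof.
move=> can; split=> [|i X _ z Vz]; first exact: can.1.
by rewrite covd_cst canonical_nabla0.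
Qed.

(** The cancellation that turns [L_E(o) = o] into the Leibniz rule for
    [nabla E - Id]. *)
Lemma euler_rearrange (V : zmodType) (a b c f p q r : V) :
  a + b - p - q + c + f = r -> q + p - r = c + a - r + (f + b - r).
Proof.
rewrite -[a + b - p - q]addrA -opprD (addrAC _ (- _) c) (addrAC _ (- _) f).
move/eqP; rewrite subr_eq => /eqP sum_abcd.
rewrite addrACA (addrACA c) (addrC (c + f)) (addrA (a + b)) sum_abcd.
by rewrite (addrC r (p + q)) [RHS]addrA addrK (addrC q).
Qed.

(** Through the parallel product, [L_E(o) = o] becomes the Leibniz rule for
    [nabla E - Id].  The left side is [nabla_E v - [E, v]], equal to [nabla_v E]
    because [nabla] is torsion-free. *)
Lemma euler_derivative phi z v : atlas phi -> img phi z ->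
  derv (fun=> v) (E phi) z + nabla phi z (E phi z) v = v.
Proof.
move=> aphi Vz.
pose B v := derv (fun=> v) (E phi) z; pose G := nabla phi z (E phi z).
have lG : linear G by exact: (connection_linearr (frob_levi_civita frobM).1).
have lB : linear B.
  move=> a x y; rewrite /B /derv scaler_sumr -big_split; apply: eq_bigr => i _ /=.
  by rewrite !mxE scalerDl scalerA.
apply/eqP; rewrite -subr_eq0; apply/eqP.
apply: (@derivation0 phi z (fun v => B v + G v - v)) => // [a x y|x y].
  rewrite lB lG scalerBr scalerDr opprD (addrACA (a *: B x) _ (a *: G x)).
  by rewrite [LHS]addrACA.
have := frob_lie_product frobM aphi (holo_vec_cst _ x) (holo_vec_cst _ y) Vz.
have := product_parallel aphi (E phi) x y Vz.
rewrite /lie !derv_cst !sub0r /covd -/G.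
rewrite -[derv (fun w => mu phi w x y) (E phi) z]/(B (mu phi z x y)).
rewrite -/(B x) -/(B y).
move=> /(canRL (addrK _)) ->.
rewrite !(muDl aphi Vz, muDr aphi Vz, muNl aphi Vz, muNr aphi Vz) !opprK.
exact: euler_rearrange.
Qed.

Lemma Qop_scalar phi s z : atlas phi -> img phi z ->
  Qop E d D' phi s z = (1 - (2 - d) / 2) *: s z.
Proof.
move=> aphi Vz; rewrite /Qop /covd /lie eqD //.
rewrite -[in RHS](euler_derivative (s z) aphi Vz).
rewrite -[derv (fun=> s z) _ _]/(derv s (E phi) z).
by rewrite opprB [X in X - _]addrC addrA subrK euler_derivative // scalerBl scale1r.
Qed.

(** By [Qop_scalar], [Q] is the real scalar [d / 2], and [kappa Q kappa = - Q]
    then says that it is its own opposite. *)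
Lemma Qop0 phi : atlas phi -> eqop (img phi) (Qop E d D' phi) 0.
Proof.
move=> aphi s sms z Vz; rewrite Qop_scalar //.
have := cv_kappa_Q (cdv_CV cdvM aphi) (smooth_vec_cst _ (s z)) Vz.
rewrite -[LHS]/(kappa phi z (Qop E d D' phi (fun w => kappa phi w (s z)) z)
                + Qop E d D' phi (fun=> s z) z).
rewrite !Qop_scalar // kappaZ // kappaK // conj_Creal; last first.
  by rewrite !(rpredB, rpred1, rpredM, rpredV, realn, cdv_d_real cdvM).
rewrite -mulr2n -scaler_nat => /eqP.
by rewrite scaler_eq0 pnatr_eq0 => /eqP ->.
Qed.

(** [kappa] maps the line of [b_a] to itself, [kappa b_a = l b_a]; then
    [kappa^2 = Id] gives [|l| = 1], and positivity of [h(b_a, b_a) = l * eta_a]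
    gives [l * eta_a = |eta_a|]. *)
Lemma canonical_kappa phi z a : pos_def (herm g kappa) ->
  canonical_coords mu phi -> img phi z ->
  kappa phi z (bvec a) = (`|eta_of g phi z a| / eta_of g phi z a) *: bvec a.
Proof.
move=> pd can Vz; have aphi := can.1.
pose l := kappa phi z (bvec a) 0 a.
have kE : kappa phi z (bvec a) = l *: bvec a.
  rewrite [LHS]row_bvec (bigD1 a) //= big1 ?addr0 // => c ca.
  rewrite -(@canonical_mul phi can z c _ Vz).
  (* x := b_c o kappa b_a lies on the line of b_c and kappa x on that of b_a,
     so h(x, x) = 0 *)
  apply/eqP; apply: contraT => /(pd _ _ _ aphi Vz).
  set x := mu phi z _ _; rewrite /herm.
  have -> : kappa phi z x = mu phi z (bvec a) (kappa phi z x).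
    rewrite (mu_kappa_mu_kappa aphi) // can.2 // eqxx.
    done.
  rewrite canonical_mul // metricZr // /x canonical_mul //.
  rewrite (Defs.metric_sym (frob_metric frobM)) // metricZr // canonical_orth //.
    by rewrite !mulr0 ltxx.
  by rewrite eq_sym.
have l1 : `|l| = 1.
  have := kappaK aphi Vz (bvec a).
  rewrite kE kappaZ // kE scalerA => /(congr1 (fun v : vec => v 0 a)).
  rewrite mxE !bvecE eqxx mulr1 mulrC -normCK => /eqP.
  by rewrite sqrp_eq1 // => /eqP.
have := pd _ _ _ aphi Vz (bvec_neq0 a).
rewrite /herm kE metricZr // -/(eta_of g phi z a).
move=> h0; have leta : l * eta_of g phi z a = `|eta_of g phi z a|.
  by rewrite -(gtr0_norm h0) normrM l1 mul1r.
congr (_ *: _); rewrite -leta mulfK //.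
by apply/eqP => eta0; move: h0; rewrite eta0 mulr0 ltxx.
Qed.

Lemma canonical_herm phi z : pos_def (herm g kappa) ->
  canonical_coords mu phi -> img phi z ->
  \matrix_(a, b) herm g kappa phi z (bvec a) (bvec b) =
    diag_mx (\row_a `|eta_of g phi z a|).
Proof.
move=> pd can Vz; have aphi := can.1; apply/matrixP => a b; rewrite !mxE.
rewrite /herm canonical_kappa // metricZr //.
have [->|ab] := eqVneq a b; last by rewrite (canonical_orth can) ?mulr0.
rewrite mulr1n -/(eta_of g phi z b); by apply: divfK; exact: canonical_eta_neq0.
Qed.

Lemma dz_canonical_metric phi i a b z : canonical_coords mu phi -> img phi z ->
  dz i (fun w => g phi w (bvec a) (bvec b)) z = 0.
Proof.
move=> can Vz; have aphi := can.1.
have [_ /(_ phi aphi) [_ LC]] := frob_levi_civita frobM.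
have [_] := LC _ _ _ (holo_vec_cst _ (bvec i)) (holo_vec_cst _ (bvec a))
  (holo_vec_cst _ (bvec b)) z Vz.
rewrite !covd_cst !canonical_nabla0 //.
rewrite metric0l // metric0r // addr0 => <-.
rewrite /der (bigD1 i) //= bvecE eqxx mul1r big1 ?addr0 // => l li.
by rewrite bvecE eq_sym (negPf li) mul0r.
Qed.

(** The image of a canonical chart may be disconnected, and [eta] is then only
    locally constant; a single polynomial potential exists after restriction to a
    polydisc. *)
Lemma semisimple_trivial : trivial_frobenius g mu nabla.
Proof.
move=> p; have [phi can dp] := ss p; set z0 := fwd phi p.
have [r r0 rV] : exists2 r : C, 0 < r & polydisc z0 r `<=` img phi.
  by apply: polydisc_sub; [exact: open_img|exact: fwd_img].
have z0_in : polydisc z0 r z0 by move=> j; rewrite subrr normr0.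
have oB : open (polydisc z0 r) by exact: open_polydisc.
pose psi := restrict_chart phi oB.
have cpsi : canonical_coords mu psi.
  exact: canonical_restrict (frob_product frobM) can.
have apsi := cpsi.1.
have Vz0 : img psi z0 by split=> //; exact: rV.
have eta_const a z : img psi z -> eta_of g psi z a = eta_of g psi z0 a.
  move=> [_ z_in].
  apply: (@polydisc_const _ _ (fun w => eta_of g psi w a) z0 r) => //.
    move=> w w_in; have [sg _] := metric_holo (frob_metric frobM) a a apsi.
    by apply: smooth_rdiff sg _; split=> //; exact: rV.
  move=> i w w_in; have Vw : img psi w by split=> //; exact: rV.
  split; first exact: dz_canonical_metric.
  by have [_] := metric_holo (frob_metric frobM) a a apsi; apply.
(* the third derivative of (u^a)^3 is 6 *)
pose c a := eta_of g psi z0 a / 6.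
exists psi, (cubic c), (cubic_mpoly c); split.
- by split.
- exact: canonical_flat.
- split=> [|i j k z Vz]; first by apply: holo_cubic; exact: open_img.
  rewrite dz3_cubic cpsi.2 //.
  have -> : 6 * c k = eta_of g psi z k.
    by rewrite eta_const // /c mulrC divfK // pnatr_eq0.
  have [->|ij] := eqVneq i j; last first.
    rewrite mulr0n metric0l //; have [jk|_] := eqVneq j k; last first.
      by rewrite mulr0 mul0r.
    by rewrite -jk (negPf ij) mulr0.
  rewrite mulr1n; have [->|jk] := eqVneq j k; first by rewrite !mulr1.
  by rewrite mulr0 (canonical_orth cpsi).
- by move=> z _; rewrite meval_cubic_mpoly.
- move=> m_gt0; apply: mdeg_cubic_mpoly => // a.
  by rewrite mulf_neq0 ?invr_eq0 ?pnatr_eq0 // (canonical_eta_neq0).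
Qed.

End FrobeniusCDV.

Theorem theorem2p7 (R : realType) (m : nat) (M : complex_manifold R m)
    (g : form_type M) (mu : prod_type M) (e E : vfield_type M) (d : Cx R)
    (nabla : prod_type M) (kappa : bundle_map_type M) (D' : prod_type M)
    (frobM : is_frobenius g mu e E d nabla)
    (cdvM : is_CDV g mu e E d kappa D') :
  (kappa_flat nabla kappa <-> same_connection D' nabla) /\
  (kappa_flat nabla kappa -> semisimple mu ->
   [/\ forall phi, canonical_coords mu phi -> flat_coordinates nabla phi,
       forall phi, atlas phi -> eqop (img phi) (Qop E d D' phi) 0,
       trivial_frobenius g mu nabla &
       pos_def (herm g kappa) ->
       forall phi, canonical_coords mu phi -> forall z, img phi z ->
         (forall a, kappa phi z (bvec a) =
                    (`|eta_of g phi z a| / eta_of g phi z a) *: bvec a) /\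
         \matrix_(a, b) herm g kappa phi z (bvec a) (bvec b) =
           diag_mx (\row_a `|eta_of g phi z a|)]).
Proof.
have flat_same := kappa_flatP frobM cdvM.
split=> // /flat_same /same_connectionP same ss; split.
- exact: (canonical_flat frobM cdvM same ss).
- exact: (Qop0 frobM cdvM same ss).
- exact: (semisimple_trivial frobM cdvM same ss).
- move=> pd phi can z Vz; split=> [a|].
    exact: (canonical_kappa frobM cdvM same a pd can Vz).
  exact: (canonical_herm frobM cdvM same pd can Vz).
Qed.
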